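(* Let $H$ be a cocommutative weak Hopf algebra in $\mathsf{C}$, let $(B,\varphi_B)$ be a left weak $H$-module algebra and let $\sigma\in Reg_{\varphi_B}(H^{\otimes 2},B)$ satisfy the twisted condition. Then the pre-obstruction $\omega_\sigma$ of $\sigma$ factors through the center of $B$.
   Context: Category. $\mathsf{C}$ is a strict symmetric monoidal category with tensor product $\otimes$, unit object $K$ and symmetry $c$, in which every idempotent splits. For an object $M$ and a morphism $f$, $M\otimes f$ and $f\otimes M$ mean $id_M\otimes f$ and $f\otimes id_M$. Algebras $(A,\eta_A,\mu_A)$ are unital and associative, coalgebras $(D,\varepsilon_D,\delta_D)$ counital and coassociative; $\delta_{D\otimes E}=(D\otimes c_{D,E}\otimes E)\circ(\delta_D\otimes\delta_E)$. $D$ is cocommutative if $c_{D,D}\circ\delta_D=\delta_D$. For $f,g:D\to A$ the convolution is $f\ast g=\mu_A\circ(f\otimes g)\circ\delta_D$. Weak Hopf algebra. An object $H$ with algebra structure $(\eta_H,\mu_H)$ and coalgebra structure $(\varepsilon_H,\delta_H)$ such that: (a1) $\delta_H\circ\mu_H=(\mu_H\otimes\mu_H)\circ\delta_{H\otimes H}$; (a2) $\varepsilon_H\circ\mu_H\circ(\mu_H\otimes H)=((\varepsilon_H\circ\mu_H)\otimes(\varepsilon_H\circ\mu_H))\circ(H\otimes\delta_H\otimes H)=((\varepsilon_H\circ\mu_H)\otimes(\varepsilon_H\circ\mu_H))\circ(H\otimes(c_{H,H}\circ\delta_H)\otimes H)$; (a3) $(\delta_H\otimes H)\circ\delta_H\circ\eta_H=(H\otimes\mu_H\otimes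 H)\circ((\delta_H\circ\eta_H)\otimes(\delta_H\circ\eta_H))=(H\otimes(\mu_H\circ c_{H,H})\otimes H)\circ((\delta_H\circ\eta_H)\otimes(\delta_H\circ\eta_H))$; and there is an antipode $\lambda_H:H\to H$ with (a4) $id_H\ast\lambda_H=\Pi_H^L:=((\varepsilon_H\circ\mu_H)\otimes H)\circ(H\otimes c_{H,H})\circ((\delta_H\circ\eta_H)\otimes H)$, (a5) $\lambda_H\ast id_H=\Pi_H^R:=(H\otimes(\varepsilon_H\circ\mu_H))\circ(c_{H,H}\otimes H)\circ(H\otimes(\delta_H\circ\eta_H))$, (a6) $\lambda_H\ast id_H\ast\lambda_H=\lambda_H$. Actions. For an algebra $B$, $(B,\varphi_B)$ with $\varphi_B:H\otimes B\to B$ is a left weak $H$-module algebra if (b1) $\varphi_B\circ(H\otimes\mu_B)=\mu_B\circ(\varphi_B\otimes\varphi_B)\circ(H\otimes c_{H,B}\otimes B)\circ(\delta_H\otimes B\otimes B)$, (b2) $\varphi_B\circ(\eta_H\otimes B)=id_B$ and (b3) $u_1^{\varphi_B}\circ\mu_H=\varphi_B\circ(H\otimes u_1^{\varphi_B})$, where $u_1^{\varphi_B}=\varphi_B\circ(H\otimes\eta_B)$. For $n\ge 2$, $u_n^{\varphi_B}=u_1^{\varphi_B}\circ m_H^{\otimes n}$, where $m_H^{\otimes n}:H^{\otimes n}\to H$ is the iterated product. Regular morphisms. $Reg_{\varphi_B}(H^{\otimes n},B)$ is the group (under $\ast$, with unit $u_n^{\varphi_B}$) of morphisms $\sigma:H^{\otimes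 n}\to B$ for which there is $\sigma^{-1}:H^{\otimes n}\to B$ with $\sigma\ast\sigma^{-1}=\sigma^{-1}\ast\sigma=u_n^{\varphi_B}$, $\sigma\ast\sigma^{-1}\ast\sigma=\sigma$, $\sigma^{-1}\ast\sigma\ast\sigma^{-1}=\sigma^{-1}$. Twisted condition on $\sigma:H\otimes H\to B$. With $P_{\varphi_B}=(\varphi_B\otimes H)\circ(H\otimes c_{H,B})\circ(\delta_H\otimes B)$ and $F_\sigma=(\sigma\otimes\mu_H)\circ\delta_{H\otimes H}$: $\mu_B\circ(B\otimes\sigma)\circ(P_{\varphi_B}\otimes H)\circ(H\otimes P_{\varphi_B})=\mu_B\circ(B\otimes\varphi_B)\circ(F_\sigma\otimes B)$. Pre-obstruction. $\omega_\sigma=\partial_{2,0}(\sigma)\ast\partial_{2,2}(\sigma)\ast\partial_{2,1}(\sigma)^{-1}\ast\partial_{2,3}(\sigma)^{-1}:H^{\otimes3}\to B$, where $\partial_{2,i}:Reg_{\varphi_B}(H^{\otimes 2},B)\to Reg_{\varphi_B}(H^{\otimes3},B)$ are $\partial_{2,0}(\sigma)=\varphi_B\circ(H\otimes\sigma)$, $\partial_{2,1}(\sigma)=\sigma\circ(\mu_H\otimes H)$, $\partial_{2,2}(\sigma)=\sigma\circ(H\otimes\mu_H)$, $\partial_{2,3}(\sigma)=\sigma\circ(H\otimes(\mu_H\circ(H\otimes\Pi_H^L)))$. Center. The center of $B$ is an object $Z(B)$ with a monomorphism $z_B:Z(B)\to B$ such that $\mu_B\circ(B\otimes z_B)=\mu_B\circ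 c_{B,B}\circ(B\otimes z_B)$ and every $f:A\to B$ with $\mu_B\circ(B\otimes f)=\mu_B\circ c_{B,B}\circ(B\otimes f)$ factors uniquely through $z_B$; it is assumed to exist. A morphism $f$ into $B$ factors through the center if $f=z_B\circ f'$ for some $f'$ (equivalently $\mu_B\circ(f\otimes B)=\mu_B\circ c_{B,B}\circ(f\otimes B)$). *)

(* Defs.v *)
From Stdlib Require Import ClassicalEpsilon.

Set Implicit Arguments.
Unset Strict Implicit.
Unset Printing Implicit Defensive.

(* Categories are presented with one type of objects and one type of all
   morphisms, so that strict associativity and unitality of the tensor product
   are plain equations between morphisms, with no transport along equalities of
   objects.  [comp g f] is total, but the axioms constrain it only when
   [cod f = dom g]; its value on other pairs is irrelevant. *)
Record category := Category {
  ob : Type;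
  mor : Type;
  dom : mor -> ob;
  cod : mor -> ob;
  idm : ob -> mor;
  comp : mor -> mor -> mor;
  dom_idm : forall A, dom (idm A) = A;
  cod_idm : forall A, cod (idm A) = A;
  dom_comp : forall g f, cod f = dom g -> dom (comp g f) = dom f;
  cod_comp : forall g f, cod f = dom g -> cod (comp g f) = cod g;
  comp_assoc : forall h g f, cod f = dom g -> cod g = dom h ->
    comp h (comp g f) = comp (comp h g) f;
  comp_idl : forall f, comp (idm (cod f)) f = f;
  comp_idr : forall f, comp f (idm (dom f)) = f
}.

Arguments dom {c} f.
Arguments cod {c} f.
Arguments idm {c} A.
Arguments comp {c} g f.

(* An object used where a morphism is expected denotes its identity, as in
   [H ⊗ f]. *)
Coercion idm : ob >-> mor.

Declare Scope ob_scope.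
Delimit Scope ob_scope with ob.
Bind Scope ob_scope with ob.
Declare Scope mor_scope.
Delimit Scope mor_scope with mor.
Bind Scope mor_scope with mor.

Definition hom (C : category) (A B : ob C) (f : mor C) : Prop :=
  dom f = A /\ cod f = B.

Notation "f ∈ A ⟶ B" := (hom A%ob B%ob f%mor)
  (at level 70, A at level 60, B at level 60, no associativity) : type_scope.
Notation "g ∘ f" := (comp g f) (at level 50, left associativity) : mor_scope.
Open Scope mor_scope.

Definition idempotents_split (C : category) : Prop :=
  forall (A : ob C) (e : mor C), e ∈ A ⟶ A -> e ∘ e = e ->
  exists (X : ob C) (i p : mor C),
    (i ∈ X ⟶ A) /\ (p ∈ A ⟶ X) /\ i ∘ p = e /\ p ∘ i = idm X.

Record strictSymMonCat := StrictSymMonCat {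
  ssm_cat :> category;
  unit_ob : ob ssm_cat;
  tens : ob ssm_cat -> ob ssm_cat -> ob ssm_cat;
  tensm : mor ssm_cat -> mor ssm_cat -> mor ssm_cat;
  sym : ob ssm_cat -> ob ssm_cat -> mor ssm_cat;
  (* the tensor product is a functor of two variables *)
  dom_tensm : forall f g, dom (tensm f g) = tens (dom f) (dom g);
  cod_tensm : forall f g, cod (tensm f g) = tens (cod f) (cod g);
  tensm_id : forall A B, tensm (idm A) (idm B) = idm (tens A B);
  tensm_comp : forall g f g' f', cod f = dom g -> cod f' = dom g' ->
    tensm (g ∘ f) (g' ∘ f') = tensm g g' ∘ tensm f f';
  (* strictness *)
  tens_assoc : forall A B D, tens A (tens B D) = tens (tens A B) D;
  tens_unitl : forall A, tens unit_ob A = A;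
  tens_unitr : forall A, tens A unit_ob = A;
  tensm_assoc : forall f g h, tensm f (tensm g h) = tensm (tensm f g) h;
  tensm_unitl : forall f, tensm (idm unit_ob) f = f;
  tensm_unitr : forall f, tensm f (idm unit_ob) = f;
  (* symmetry *)
  sym_hom : forall A B, sym A B ∈ tens A B ⟶ tens B A;
  sym_nat : forall f g,
    sym (cod f) (cod g) ∘ tensm f g = tensm g f ∘ sym (dom f) (dom g);
  sym_inv : forall A B, sym B A ∘ sym A B = idm (tens A B);
  sym_hexagon : forall A B D,
    sym A (tens B D) = tensm (idm B) (sym A D) ∘ tensm (sym A B) (idm D)
}.

Arguments unit_ob {s}.
Arguments tens {s} A B.
Arguments tensm {s} f g.
Arguments sym {s} A B.

Notation "A ⊗ B" := (tens A B) (at level 40, left associativity) : ob_scope.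
Notation "f ⊗ g" := (tensm f g) (at level 40, left associativity) : mor_scope.

Record algebra (C : strictSymMonCat) := Algebra {
  alg_ob :> ob C;
  eta : mor C;
  mu : mor C;
  eta_hom : eta ∈ unit_ob ⟶ alg_ob;
  mu_hom : mu ∈ alg_ob ⊗ alg_ob ⟶ alg_ob;
  mu_etal : mu ∘ (eta ⊗ alg_ob) = idm alg_ob;
  mu_etar : mu ∘ (alg_ob ⊗ eta) = idm alg_ob;
  mu_assoc : mu ∘ (mu ⊗ alg_ob) = mu ∘ (alg_ob ⊗ mu)
}.

Record is_coalgebra (C : strictSymMonCat) (D : ob C) (eps delta : mor C)
    : Prop := IsCoalgebra {
  eps_hom : eps ∈ D ⟶ unit_ob;
  delta_hom : delta ∈ D ⟶ D ⊗ D;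
  delta_epsl : (eps ⊗ D) ∘ delta = idm D;
  delta_epsr : (D ⊗ eps) ∘ delta = idm D;
  delta_assoc : (delta ⊗ D) ∘ delta = (D ⊗ delta) ∘ delta
}.

(* The coproduct of [D ⊗ E] from the coproducts of [D] and [E]. *)
Definition delta_tens (C : strictSymMonCat) (D E : ob C) (deltaD deltaE : mor C)
    : mor C :=
  (D ⊗ sym D E ⊗ E) ∘ (deltaD ⊗ deltaE).

Definition conv (C : strictSymMonCat) (A : algebra C) (delta f g : mor C)
    : mor C :=
  mu A ∘ (f ⊗ g) ∘ delta.

Definition target_map (C : strictSymMonCat) (A : algebra C) (eps delta : mor C)
    : mor C :=
  ((eps ∘ mu A) ⊗ A) ∘ (A ⊗ sym A A) ∘ ((delta ∘ eta A) ⊗ A).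

Definition source_map (C : strictSymMonCat) (A : algebra C) (eps delta : mor C)
    : mor C :=
  (A ⊗ (eps ∘ mu A)) ∘ (sym A A ⊗ A) ∘ (A ⊗ (delta ∘ eta A)).

Record is_weak_hopf (C : strictSymMonCat) (H : algebra C)
    (eps delta lam : mor C) : Prop := IsWeakHopf {
  wh_coalgebra : is_coalgebra H eps delta;
  wh_mult :
    delta ∘ mu H = (mu H ⊗ mu H) ∘ delta_tens H H delta delta;
  wh_counit :
    eps ∘ mu H ∘ (mu H ⊗ H)
    = ((eps ∘ mu H) ⊗ (eps ∘ mu H)) ∘ (H ⊗ delta ⊗ H);
  wh_counit_sym :
    eps ∘ mu H ∘ (mu H ⊗ H)
    = ((eps ∘ mu H) ⊗ (eps ∘ mu H)) ∘ (H ⊗ (sym H H ∘ delta) ⊗ H);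
  wh_unit :
    (delta ⊗ H) ∘ delta ∘ eta H
    = (H ⊗ mu H ⊗ H) ∘ ((delta ∘ eta H) ⊗ (delta ∘ eta H));
  wh_unit_sym :
    (delta ⊗ H) ∘ delta ∘ eta H
    = (H ⊗ (mu H ∘ sym H H) ⊗ H) ∘ ((delta ∘ eta H) ⊗ (delta ∘ eta H));
  wh_antipode_hom : lam ∈ H ⟶ H;
  wh_antipodel : conv H delta (idm H) lam = target_map H eps delta;
  wh_antipoder : conv H delta lam (idm H) = source_map H eps delta;
  wh_antipode : conv H delta (conv H delta lam (idm H)) lam = lam
}.

Record weakHopf (C : strictSymMonCat) := WeakHopf {
  wh_alg :> algebra C;
  counit : mor C;
  comult : mor C;
  antipode : mor C;
  wh_axioms : is_weak_hopf wh_alg counit comult antipode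
}.

Definition cocommutative (C : strictSymMonCat) (H : weakHopf C) : Prop :=
  sym H H ∘ comult H = comult H.

Definition PiL (C : strictSymMonCat) (H : weakHopf C) : mor C :=
  target_map H (counit H) (comult H).

(* [H^{⊗n}] with its coproduct and iterated product.  The case [n = 1] is
   separate so that [pow_ob H 2] reduces to [H ⊗ H]. *)
Fixpoint pow_ob (C : strictSymMonCat) (H : weakHopf C) (n : nat) : ob C :=
  match n with
  | 0 => unit_ob
  | 1 => H
  | S m => pow_ob H m ⊗ H
  end.

Fixpoint pow_delta (C : strictSymMonCat) (H : weakHopf C) (n : nat) : mor C :=
  match n with
  | 0 => unit_ob
  | 1 => comult H
  | S m => delta_tens (pow_ob H m) H (pow_delta H m) (comult H)
  end.

Fixpoint pow_mu (C : strictSymMonCat) (H : weakHopf C) (n : nat) : mor C :=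
  match n with
  | 0 => eta H
  | 1 => H
  | S m => mu H ∘ (pow_mu H m ⊗ H)
  end.

Record weak_module_algebra (C : strictSymMonCat) (H : weakHopf C)
    (B : algebra C) (phi : mor C) : Prop := WeakModuleAlgebra {
  wma_hom : phi ∈ H ⊗ B ⟶ B;
  wma_mult :
    phi ∘ (H ⊗ mu B)
    = mu B ∘ (phi ⊗ phi) ∘ (H ⊗ sym H B ⊗ B) ∘ (comult H ⊗ B ⊗ B);
  wma_unit : phi ∘ (eta H ⊗ B) = idm B;
  wma_weak : (phi ∘ (H ⊗ eta B)) ∘ mu H = phi ∘ (H ⊗ (phi ∘ (H ⊗ eta B)))
}.

Section Obstruction.

Variables (C : strictSymMonCat) (H : weakHopf C) (B : algebra C) (phi : mor C).

Definition u_ (n : nat) : mor C := phi ∘ (H ⊗ eta B) ∘ pow_mu H n.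

Definition convn (n : nat) (f g : mor C) : mor C := conv B (pow_delta H n) f g.

Definition is_reg_inv (n : nat) (s t : mor C) : Prop :=
  (t ∈ pow_ob H n ⟶ B) /\
  convn n s t = u_ n /\ convn n t s = u_ n /\
  convn n (convn n s t) s = s /\ convn n (convn n t s) t = t.

Definition reg (n : nat) (s : mor C) : Prop :=
  (s ∈ pow_ob H n ⟶ B) /\ exists t, is_reg_inv n s t.

(* The inverse of [s] in [Reg(H^{⊗n}, B)]; it is unique when it exists. *)
Definition reg_inv (n : nat) (s : mor C) : mor C :=
  epsilon (inhabits s) (is_reg_inv n s).

Definition P_ : mor C := (phi ⊗ H) ∘ (H ⊗ sym H B) ∘ (comult H ⊗ B).

Definition F_ (s : mor C) : mor C :=
  (s ⊗ mu H) ∘ delta_tens H H (comult H) (comult H).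

Definition twisted (s : mor C) : Prop :=
  mu B ∘ (B ⊗ s) ∘ (P_ ⊗ H) ∘ (H ⊗ P_) = mu B ∘ (B ⊗ phi) ∘ (F_ s ⊗ B).

Definition d20 (s : mor C) : mor C := phi ∘ (H ⊗ s).
Definition d21 (s : mor C) : mor C := s ∘ (mu H ⊗ H).
Definition d22 (s : mor C) : mor C := s ∘ (H ⊗ mu H).
Definition d23 (s : mor C) : mor C := s ∘ (H ⊗ (mu H ∘ (H ⊗ PiL H))).

Definition preobstruction (s : mor C) : mor C :=
  convn 3 (convn 3 (convn 3 (d20 s) (d22 s)) (reg_inv 3 (d21 s)))
        (reg_inv 3 (d23 s)).

End Obstruction.

Definition centralizes (C : strictSymMonCat) (B : algebra C) (f : mor C)
    : Prop :=
  mu B ∘ (B ⊗ f) = mu B ∘ sym B B ∘ (B ⊗ f).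

Record center (C : strictSymMonCat) (B : algebra C) := Center {
  center_ob :> ob C;
  center_in : mor C;
  center_in_hom : center_in ∈ center_ob ⟶ B;
  center_in_mono : forall (X : ob C) (g h : mor C),
    g ∈ X ⟶ center_ob -> h ∈ X ⟶ center_ob ->
    center_in ∘ g = center_in ∘ h -> g = h;
  center_in_centralizes : centralizes B center_in;
  center_universal : forall (A : ob C) (f : mor C),
    f ∈ A ⟶ B -> centralizes B f ->
    exists! f' : mor C, (f' ∈ A ⟶ center_ob) /\ f = center_in ∘ f'
}.

Definition factors_through_center (C : strictSymMonCat) (B : algebra C)
    (Z : center B) (A : ob C) (f : mor C) : Prop :=
  exists f' : mor C, (f' ∈ A ⟶ Z) /\ f = center_in Z ∘ f'.

(* Main.v *)
From Stdlib Require Import ProofIrrelevance ClassicalEpsilon.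
Require Import Defs.

Set Implicit Arguments.
Unset Strict Implicit.
Unset Printing Implicit Defensive.

(** Let D be the cocommutative coalgebra H⊗H⊗H.  A morphism D⊗Y ⟶ X is a
    morphism Y ⟶ X depending on a parameter in D, and two of them are combined
    by copying the parameter ([pairing]).  For this calculus the convolution
    product of D ⟶ B is plain multiplication, and the three projections
    h, k, l : D ⟶ H become elements with δ(h) = h⊗h ([grouplike]), so that all
    computations can be done with elements as if H were a groupoid.  With
    h·b = φ(h⊗b) and u(h) = h·1, the hypotheses become: h·(ab) = (h·a)(h·b),
    u(hk) = h·u(k), σ(h,k) has an inverse relative to the idempotent u(hk), and
    the twisted condition is

      (h·(k·b)) σ(h,k) = σ(h,k) ((hk)·b)                      [twisted_act].

    Put T(b) = h·(k·(l·b)).  Moving b through σ along the two bracketings of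
    hkl shows that both X = (h·σ(k,l)) σ(h,kl) and Y = σ(h,kΠ(l)) σ(hk,l), for
    Π = [PiL H], satisfy T(b) X = X ((hkl)·b) and T(b) Y = Y ((hkl)·b).  Hence
    ω = X Y⁻¹ commutes with every T(b).  It remains to see that the values of T
    are all of B up to the unit u(hkl).  Here hλ(h) = Π(h), and Π(h) acts as
    multiplication by the central element u(h) ([act_target_l],
    [act_target_r]); so by the twisted condition h·(λ(h)·b) is b conjugated by
    σ(h,λ(h)), and conjugating back gives a preimage of u(h)b
    ([act_surjective]).  Since ω absorbs u(hkl), it commutes with every b
    ([obstruction_central]).

    The twisted condition may be used at (h, λ(h)) only if λ(h) is again
    grouplike, that is, if λ is comultiplicative ([comult_antipode]).  In the
    convolution semigroup of H⊗H both δλ and (λ⊗λ)δ are generalized inverses of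
    δ, and these agree as soon as the idempotents δΠ and (Π⊗Π)δ, and their
    source analogues, commute; that holds because
    δ(Π(h)) = δ(1)(Π(h)⊗1) = (Π(h)⊗1)δ(1), which is also what makes Π(h) act by
    multiplication. *)

(** * Strict symmetric monoidal categories *)
Lemma hom_dom (C : category) (A B : ob C) (f : mor C) : f ∈ A ⟶ B -> dom f = A.
Proof. intros h; exact (proj1 h). Qed.
Lemma hom_cod (C : category) (A B : ob C) (f : mor C) : f ∈ A ⟶ B -> cod f = B.
Proof. intros h; exact (proj2 h). Qed.

Lemma dom_mu (C : strictSymMonCat) (A : algebra C) : dom (mu A) = (A ⊗ A)%ob.
Proof. exact (hom_dom (mu_hom A)). Qed.
Lemma cod_mu (C : strictSymMonCat) (A : algebra C) : cod (mu A) = A.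
Proof. exact (hom_cod (mu_hom A)). Qed.
Lemma dom_eta (C : strictSymMonCat) (A : algebra C) : dom (eta A) = unit_ob.
Proof. exact (hom_dom (eta_hom A)). Qed.
Lemma cod_eta (C : strictSymMonCat) (A : algebra C) : cod (eta A) = A.
Proof. exact (hom_cod (eta_hom A)). Qed.
Lemma dom_sym (C : strictSymMonCat) (A B : ob C) : dom (sym A B) = (A ⊗ B)%ob.
Proof. exact (hom_dom (sym_hom A B)). Qed.
Lemma cod_sym (C : strictSymMonCat) (A B : ob C) : cod (sym A B) = (B ⊗ A)%ob.
Proof. exact (hom_cod (sym_hom A B)). Qed.

Ltac ob_norm := rewrite ?tens_assoc, ?tens_unitl, ?tens_unitr.

(** Proves typing goals: it computes domains and codomains bottom-up, recursing
    for the composability of each composite, and then compares objects after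
    flattening tensors.  [ty_hook] is extended for each later construction. *)
Ltac ty_hook := fail.
Ltac ty_core :=
  repeat match goal with
  | |- context [dom (idm ?A)] => rewrite (dom_idm A)
  | |- context [cod (idm ?A)] => rewrite (cod_idm A)
  | |- context [dom (tensm ?f ?g)] => rewrite (dom_tensm f g)
  | |- context [cod (tensm ?f ?g)] => rewrite (cod_tensm f g)
  | |- context [dom (sym ?f ?g)] => rewrite (dom_sym f g)
  | |- context [cod (sym ?f ?g)] => rewrite (cod_sym f g)
  | |- context [dom (mu ?A)] => rewrite (dom_mu A)
  | |- context [cod (mu ?A)] => rewrite (cod_mu A)
  | |- context [dom (eta ?A)] => rewrite (dom_eta A)
  | |- context [cod (eta ?A)] => rewrite (cod_eta A)
  | |- context [dom (?g ∘ ?f)] => rewrite (@dom_comp _ g f) by ty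
  | |- context [cod (?g ∘ ?f)] => rewrite (@cod_comp _ g f) by ty
  | h : dom ?f = _ |- context [dom ?f] => rewrite h
  | h : cod ?f = _ |- context [cod ?f] => rewrite h
  | h : hom _ _ ?f |- context [dom ?f] => rewrite (hom_dom h)
  | h : hom _ _ ?f |- context [cod ?f] => rewrite (hom_cod h)
  | |- _ => progress ty_hook
  end
with ty :=
  first [ assumption | reflexivity |
  lazymatch goal with
  | |- hom _ _ _ => split; ty_core; ob_norm; reflexivity
  | |- _ => ty_core; ob_norm; reflexivity
  end ].

Ltac flat := rewrite <- ?tensm_id, ?tensm_assoc; reflexivity.

Section Basics.
Variable C : strictSymMonCat.
Implicit Types (A B D X Y Z : ob C) (f g h k t : mor C).

Lemma comp_id_r A B f : f ∈ A ⟶ B -> f ∘ A = f.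
Proof. intros [<- _]; apply comp_idr. Qed.
Lemma comp_id_l A B f : f ∈ A ⟶ B -> B ∘ f = f.
Proof. intros [_ <-]; apply comp_idl. Qed.

Lemma id_l B f : B = cod f -> idm B ∘ f = f.
Proof. intros ->; apply comp_idl. Qed.
Lemma id_r A f : A = dom f -> f ∘ idm A = f.
Proof. intros ->; apply comp_idr. Qed.

(** Rewrites with an equation between composites at the head of a right-nested
    chain. *)
Lemma comp_tail g f x t :
  g ∘ f = x -> cod t = dom f -> cod f = dom g -> g ∘ (f ∘ t) = x ∘ t.
Proof. intros <- h1 h2; now apply comp_assoc. Qed.

Lemma tens_split A A' B B' f g : f ∈ A ⟶ A' -> g ∈ B ⟶ B' ->
  f ⊗ g = (f ⊗ B') ∘ (A ⊗ g).
Proof.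
  intros hf hg; rewrite <- tensm_comp by ty.
  now rewrite (comp_id_r hf), (comp_id_l hg).
Qed.
Lemma tens_split' A A' B B' f g : f ∈ A ⟶ A' -> g ∈ B ⟶ B' ->
  f ⊗ g = (A' ⊗ g) ∘ (f ⊗ B).
Proof.
  intros hf hg; rewrite <- tensm_comp by ty.
  now rewrite (comp_id_r hg), (comp_id_l hf).
Qed.
Lemma tens_merge f g A B : dom f = A -> cod g = B ->
  (f ⊗ B) ∘ (A ⊗ g) = f ⊗ g.
Proof. intros <- <-; symmetry; apply (tens_split (A' := cod f) (B := dom g)); ty. Qed.
Lemma tens_merge' f g A B : cod f = A -> dom g = B ->
  (A ⊗ g) ∘ (f ⊗ B) = f ⊗ g.
Proof. intros <- <-; symmetry; apply (tens_split' (A := dom f) (B' := cod g)); ty. Qed.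
Lemma tens_comp_l A f g : cod f = dom g -> A ⊗ (g ∘ f) = (A ⊗ g) ∘ (A ⊗ f).
Proof.
  intros e; rewrite <- tensm_comp by ty; f_equal; symmetry.
  apply (@comp_id_r A A); ty.
Qed.
Lemma tens_comp_r A f g : cod f = dom g -> (g ∘ f) ⊗ A = (g ⊗ A) ∘ (f ⊗ A).
Proof.
  intros e; rewrite <- tensm_comp by ty; f_equal; symmetry.
  apply (@comp_id_r A A); ty.
Qed.

Lemma sym_natural A A' B B' f g : f ∈ A ⟶ A' -> g ∈ B ⟶ B' ->
  sym A' B' ∘ (f ⊗ g) = (g ⊗ f) ∘ sym A B.
Proof. intros [<- <-] [<- <-]; apply sym_nat. Qed.

Lemma sym_natural_l A A' B f : f ∈ A ⟶ A' ->
  sym A' B ∘ (f ⊗ B) = (B ⊗ f) ∘ sym A B.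
Proof. intros hf; apply sym_natural; ty. Qed.
Lemma sym_natural_r A B B' f : f ∈ B ⟶ B' ->
  sym A B' ∘ (A ⊗ f) = (f ⊗ A) ∘ sym A B.
Proof. intros hf; apply sym_natural; ty. Qed.

(** The hexagon at two unit objects says that this symmetry is idempotent, and
    it is invertible. *)
Lemma sym_unit_r A : sym A unit_ob = idm A.
Proof.
  pose proof (sym_hexagon A unit_ob unit_ob) as e.
  rewrite tensm_unitl, tensm_unitr, tens_unitl in e.
  assert (hs : sym A unit_ob ∈ A ⟶ A) by ty.
  pose proof (sym_inv A unit_ob) as i; rewrite tens_unitr in i.
  transitivity (A ∘ sym A unit_ob); [symmetry; exact (comp_id_l hs)|].
  rewrite <- i at 1; rewrite <- comp_assoc, <- e by ty; exact i.
Qed.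

Lemma sym_unit_l A : sym unit_ob A = idm A.
Proof.
  pose proof (sym_inv unit_ob A) as i. rewrite sym_unit_r, tens_unitl in i.
  rewrite <- i. symmetry; apply (@comp_id_l A A); ty.
Qed.

(** The inverse of the other hexagon, because the symmetry is involutive. *)
Lemma sym_hexagon_l A B D :
  sym (A ⊗ B) D = (sym A D ⊗ B) ∘ (A ⊗ sym B D).
Proof.
  assert (e : ((sym A D ⊗ B) ∘ (A ⊗ sym B D)) ∘ sym D (A ⊗ B) = idm (D ⊗ A ⊗ B)%ob).
  { rewrite sym_hexagon. rewrite <- comp_assoc by ty.
    rewrite (@comp_assoc _ (A ⊗ sym B D)) by ty.
    rewrite <- tens_comp_l, sym_inv, tensm_id, id_l by ty.
    rewrite <- tens_comp_r, sym_inv, tensm_id by ty. reflexivity. }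
  pose proof (sym_inv (A ⊗ B)%ob D) as i.
  rewrite <- (@comp_id_r (A ⊗ B ⊗ D)%ob (D ⊗ A ⊗ B)%ob ((sym A D ⊗ B) ∘ (A ⊗ sym B D))) by ty.
  rewrite <- i, comp_assoc by ty. rewrite e.
  symmetry; apply (@comp_id_l (A ⊗ B ⊗ D)%ob (D ⊗ A ⊗ B)%ob); ty.
Qed.

End Basics.

(** * Tensor products of algebras *)
Section TensorAlgebra.
Variable C : strictSymMonCat.
Implicit Types (A B D X Y Z : ob C) (f g h k t : mor C).

Lemma tens3_comp f g h f' g' h' :
  cod f = dom f' -> cod g = dom g' -> cod h = dom h' ->
  (f' ⊗ g' ⊗ h') ∘ (f ⊗ g ⊗ h) = (f' ∘ f) ⊗ (g' ∘ g) ⊗ (h' ∘ h).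
Proof.
  intros e1 e2 e3; rewrite !tensm_comp by (ty_core; congruence); reflexivity.
Qed.

(** Both sides permute A B X Y into B Y A X.  The identity makes tensor products
    of cocommutative coalgebras cocommutative, and the swap a morphism for the
    multiplication of a tensor square. *)
Lemma sym_interchange A B X Y :
  sym (A ⊗ X) (B ⊗ Y) ∘ (A ⊗ sym B X ⊗ Y)
  = (B ⊗ sym A Y ⊗ X) ∘ (sym A B ⊗ sym X Y).
Proof.
  rewrite sym_hexagon, !sym_hexagon_l.
  rewrite !tens_comp_l, !tens_comp_r by ty.
  rewrite !tensm_assoc.
  rewrite <- !comp_assoc by ty.
  rewrite <- (tens_comp_r Y (g := A ⊗ sym X B)), <- tens_comp_l, sym_inv by ty.
  rewrite !tensm_id, id_r by ty.
  rewrite (tens_split' (sym_hom A B) (sym_hom X Y)).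
  now rewrite <- (tensm_id B), <- (tensm_id X), tensm_assoc.
Qed.

Variables A B : algebra C.

Definition tens_mu : mor C := (mu A ⊗ mu B) ∘ (A ⊗ sym B A ⊗ B).

Lemma tens_mu_hom : tens_mu ∈ A ⊗ B ⊗ (A ⊗ B) ⟶ A ⊗ B.
Proof. unfold tens_mu; ty. Qed.
Lemma tens_eta_hom : eta A ⊗ eta B ∈ unit_ob ⟶ A ⊗ B.
Proof. ty. Qed.

Lemma tens_mu_etal : tens_mu ∘ ((eta A ⊗ eta B) ⊗ (A ⊗ B)%ob) = idm (A ⊗ B)%ob.
Proof.
  unfold tens_mu; rewrite <- tensm_id, tensm_assoc, <- comp_assoc by ty.
  rewrite <- (tensm_assoc (eta A)).
  rewrite <- tensm_comp by ty; rewrite <- (tensm_comp (g := idm A)) by ty.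
  assert (e : sym B A ∘ (eta B ⊗ A) = A ⊗ eta B).
  { rewrite (sym_natural_l A (eta_hom B)), sym_unit_l; apply id_r; ty. }
  rewrite e, (id_l (f := eta A)), (id_l (f := idm B)) by ty.
  rewrite tensm_assoc, <- (tensm_assoc (eta A ⊗ A)), <- tensm_comp by ty.
  now rewrite !mu_etal.
Qed.

Lemma tens_mu_etar : tens_mu ∘ ((A ⊗ B)%ob ⊗ (eta A ⊗ eta B)) = idm (A ⊗ B)%ob.
Proof.
  unfold tens_mu; rewrite <- tensm_id, tensm_assoc, <- comp_assoc by ty.
  rewrite <- (tensm_assoc A B).
  rewrite <- tensm_comp by ty; rewrite <- (tensm_comp (g := idm A)) by ty.
  assert (e : sym B A ∘ (B ⊗ eta A) = eta A ⊗ B).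
  { rewrite (sym_natural_r B (eta_hom A)), sym_unit_r; apply id_r; ty. }
  rewrite e, (id_l (f := eta B)), (id_l (f := idm A)) by ty.
  rewrite tensm_assoc, <- (tensm_assoc (A ⊗ eta A)), <- tensm_comp by ty.
  now rewrite !mu_etar.
Qed.

Lemma tens_mu_assoc :
  tens_mu ∘ (tens_mu ⊗ (A ⊗ B)%ob) = tens_mu ∘ ((A ⊗ B)%ob ⊗ tens_mu).
Proof.
  (* Both sides multiply three A's and three B's after the same shuffle: [l] and
     [r] pull the products to the left, and [m] compares the shuffles. *)
  assert (l : (A ⊗ sym B A ⊗ B) ∘ (mu A ⊗ mu B ⊗ A ⊗ B)
    = (mu A ⊗ A ⊗ (mu B ⊗ B)) ∘ (A ⊗ A ⊗ sym (B ⊗ B) A ⊗ B)).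
  { rewrite <- (tensm_assoc (mu A) (mu B)), tens3_comp by ty.
    rewrite (sym_natural_l A (mu_hom B)).
    rewrite tensm_assoc, <- (tensm_assoc (mu A) A), tens3_comp by ty.
    now rewrite !tensm_id, !id_l, !id_r by ty. }
  assert (r : (A ⊗ sym B A ⊗ B) ∘ (A ⊗ B ⊗ mu A ⊗ mu B)
    = (A ⊗ mu A ⊗ (B ⊗ mu B)) ∘ (A ⊗ sym B (A ⊗ A) ⊗ B ⊗ B)).
  { rewrite <- (tensm_assoc A B), tens3_comp by ty.
    rewrite (sym_natural_r B (mu_hom A)).
    transitivity ((A ⊗ (mu A ⊗ B) ⊗ mu B) ∘ (A ⊗ sym B (A ⊗ A) ⊗ (B ⊗ B)%ob)).
    - rewrite tens3_comp by ty. now rewrite !id_l, !id_r by ty.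
    - now rewrite <- tensm_id, !tensm_assoc. }
  assert (m : (A ⊗ A ⊗ sym (B ⊗ B) A ⊗ B) ∘ (A ⊗ sym B A ⊗ B ⊗ A ⊗ B)
    = (A ⊗ sym B (A ⊗ A) ⊗ B ⊗ B) ∘ (A ⊗ B ⊗ A ⊗ sym B A ⊗ B)).
  { rewrite sym_hexagon_l, sym_hexagon, (tensm_id A A).
    rewrite !tens_comp_l, !tens_comp_r by ty.
    rewrite <- (tensm_id A A), !tensm_assoc, <- !comp_assoc by ty. f_equal.
    transitivity (((A ⊗ A ⊗ B)%ob ⊗ (sym B A ⊗ B)) ∘ ((A ⊗ sym B A) ⊗ (B ⊗ A ⊗ B)%ob));
      [f_equal; flat|].
    transitivity (((A ⊗ sym B A) ⊗ (A ⊗ B ⊗ B)%ob) ∘ ((A ⊗ B ⊗ A)%ob ⊗ (sym B A ⊗ B)));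
      [|f_equal; flat].
    rewrite <- (tens_split' (A := (A ⊗ B ⊗ A)%ob) (A' := (A ⊗ A ⊗ B)%ob)
      (B := (B ⊗ A ⊗ B)%ob) (B' := (A ⊗ B ⊗ B)%ob)) by ty.
    rewrite <- (tens_split (A := (A ⊗ B ⊗ A)%ob) (A' := (A ⊗ A ⊗ B)%ob)
      (B := (B ⊗ A ⊗ B)%ob) (B' := (A ⊗ B ⊗ B)%ob)) by ty.
    reflexivity. }
  transitivity (((mu A ∘ (mu A ⊗ A)) ⊗ (mu B ∘ (mu B ⊗ B)))
    ∘ ((A ⊗ A ⊗ sym (B ⊗ B) A ⊗ B) ∘ (A ⊗ sym B A ⊗ B ⊗ A ⊗ B))).
  - unfold tens_mu; rewrite tens_comp_r, <- (tensm_id A B), !tensm_assoc by ty.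
    rewrite <- !comp_assoc by ty.
    rewrite (comp_tail l), <- !comp_assoc by ty.
    rewrite comp_assoc, <- tensm_comp by ty. reflexivity.
  - rewrite !mu_assoc, m. unfold tens_mu; rewrite tens_comp_l, <- (tensm_id A B), !tensm_assoc by ty.
    rewrite <- !comp_assoc by ty.
    rewrite (comp_tail r), <- !comp_assoc by ty.
    symmetry; rewrite comp_assoc, <- tensm_comp by ty; reflexivity.
Qed.

Definition tens_algebra : algebra C :=
  Algebra tens_eta_hom tens_mu_hom tens_mu_etal tens_mu_etar tens_mu_assoc.

End TensorAlgebra.

(** * Morphisms with a parameter in a coalgebra *)
Section Pairing.
Variable C : strictSymMonCat.
Implicit Types (X Y Z : ob C) (f g h k t : mor C).
Variables (D : ob C) (delta : mor C).
Hypothesis delta_D : delta ∈ D ⟶ D ⊗ D.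

(** Combines f : D⊗Y ⟶ X and g : D⊗Y' ⟶ X' by copying the parameter in D; the
    tensor product of morphisms in the coKleisli category of D⊗-.  A point
    D ⟶ X is the case Y = K, since D⊗K = D. *)
Definition pairing Y Y' f g : mor C :=
  (f ⊗ g) ∘ ((D ⊗ sym D Y ⊗ Y') ∘ (delta ⊗ Y ⊗ Y')).

Lemma pair_dom Y Y' f g : dom f = (D ⊗ Y)%ob -> dom g = (D ⊗ Y')%ob ->
  dom (pairing Y Y' f g) = (D ⊗ Y ⊗ Y')%ob.
Proof. intros hf hg; unfold pairing; ty. Qed.
Lemma pair_cod Y Y' f g : dom f = (D ⊗ Y)%ob -> dom g = (D ⊗ Y')%ob ->
  cod (pairing Y Y' f g) = (cod f ⊗ cod g)%ob.
Proof. intros hf hg; unfold pairing; ty. Qed.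

Lemma tens_pair Y Y' f g p q :
  dom f = (D ⊗ Y)%ob -> dom g = (D ⊗ Y')%ob -> cod f = dom p -> cod g = dom q ->
  (p ⊗ q) ∘ pairing Y Y' f g = pairing Y Y' (p ∘ f) (q ∘ g).
Proof.
  intros hf hg hp hq; unfold pairing.
  now rewrite (comp_assoc (h := p ⊗ q)), tensm_comp by ty.
Qed.

(** Three copies of the parameter are made on either side.  After the copies are
    moved to the front by naturality of the symmetry, the two sides differ by
    coassociativity and one interchange of disjoint swaps. *)
Lemma pair_assoc Y Y' Y'' f g k :
  (delta ⊗ D) ∘ delta = (D ⊗ delta) ∘ delta ->
  dom f = (D ⊗ Y)%ob -> dom g = (D ⊗ Y')%ob -> dom k = (D ⊗ Y'')%ob ->
  pairing Y (Y' ⊗ Y'') f (pairing Y' Y'' g k)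
  = pairing (Y ⊗ Y') Y'' (pairing Y Y' f g) k.
Proof.
  intros co hf hg hk; unfold pairing.
  set (T := (f ⊗ g ⊗ k) ∘ ((D ⊗ Y ⊗ D ⊗ sym D Y' ⊗ Y'') ∘
     ((D ⊗ sym (D ⊗ D) Y ⊗ Y' ⊗ Y'') ∘ (((D ⊗ delta) ∘ delta) ⊗ Y ⊗ Y' ⊗ Y'')))).
  transitivity T; unfold T.
  - assert (n : (D ⊗ Y ⊗ delta ⊗ Y' ⊗ Y'') ∘ (D ⊗ sym D Y ⊗ Y' ⊗ Y'')
      = (D ⊗ sym (D ⊗ D) Y ⊗ Y' ⊗ Y'') ∘ (D ⊗ delta ⊗ Y ⊗ Y' ⊗ Y'')).
    { rewrite <- !tens_comp_r, <- !(tensm_assoc D), <- !tens_comp_l by ty.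
      now rewrite (sym_natural_l Y delta_D). }
    transitivity ((f ⊗ g ⊗ k) ∘ ((D ⊗ Y ⊗ D ⊗ sym D Y' ⊗ Y'') ∘
      ((D ⊗ Y ⊗ delta ⊗ Y' ⊗ Y'') ∘ ((D ⊗ sym D Y ⊗ Y' ⊗ Y'') ∘ (delta ⊗ Y ⊗ Y' ⊗ Y''))))).
    + transitivity ((f ⊗ ((g ⊗ k) ∘ ((D ⊗ sym D Y' ⊗ Y'') ∘ (delta ⊗ Y' ⊗ Y'')))) ∘
       (((D ⊗ Y)%ob ⊗ (D ⊗ Y' ⊗ Y'')%ob) ∘ ((D ⊗ sym D Y ⊗ Y' ⊗ Y'') ∘ (delta ⊗ Y ⊗ Y' ⊗ Y'')))).
      { f_equal. rewrite (tensm_id (D ⊗ Y)), id_l by ty. f_equal; flat. }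
      rewrite comp_assoc, <- tensm_comp by ty.
      rewrite id_r, id_r by ty.
      rewrite <- (@id_r _ (D ⊗ Y)%ob f) at 1 by ty.
      rewrite tensm_comp by ty.
      rewrite tens_comp_l by ty.
      rewrite <- tensm_id, !tensm_assoc, <- !comp_assoc by ty. reflexivity.
    + do 2 f_equal. rewrite (comp_tail n) by ty. rewrite <- comp_assoc by ty. f_equal.
      rewrite <- !tens_comp_r by ty. reflexivity.
  - rewrite <- co.
    assert (n : (delta ⊗ Y ⊗ Y' ⊗ D ⊗ Y'') ∘ (D ⊗ sym D (Y ⊗ Y') ⊗ Y'')
      = (D ⊗ D ⊗ sym D (Y ⊗ Y') ⊗ Y'') ∘ (delta ⊗ D ⊗ Y ⊗ Y' ⊗ Y'')).
    { transitivity ((delta ⊗ (Y ⊗ Y' ⊗ D)%ob ⊗ Y'') ∘ (D ⊗ sym D (Y ⊗ Y') ⊗ Y''));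
        [f_equal; flat|].
      transitivity (((D ⊗ D)%ob ⊗ sym D (Y ⊗ Y') ⊗ Y'') ∘ (delta ⊗ (D ⊗ Y ⊗ Y')%ob ⊗ Y''));
        [|f_equal; flat].
      rewrite <- !tens_comp_r by ty.
      now rewrite tens_merge, tens_merge' by ty. }
    assert (m : (D ⊗ Y ⊗ D ⊗ sym D Y' ⊗ Y'') ∘ (D ⊗ sym (D ⊗ D) Y ⊗ Y' ⊗ Y'')
      = (D ⊗ sym D Y ⊗ Y' ⊗ D ⊗ Y'') ∘ (D ⊗ D ⊗ sym D (Y ⊗ Y') ⊗ Y'')).
    { rewrite sym_hexagon, sym_hexagon_l.
      transitivity (D ⊗ ((Y ⊗ D ⊗ sym D Y') ∘ (((sym D Y ⊗ D) ∘ (D ⊗ sym D Y)) ⊗ Y')) ⊗ Y'').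
      { symmetry; rewrite (tens_comp_l D), (tens_comp_r Y'') by ty; f_equal; flat. }
      transitivity (D ⊗ ((sym D Y ⊗ Y' ⊗ D) ∘ (D ⊗ ((Y ⊗ sym D Y') ∘ (sym D Y ⊗ Y')))) ⊗ Y'').
      2:{ rewrite (tens_comp_l D), (tens_comp_r Y'') by ty; f_equal; flat. }
      do 2 f_equal.
      rewrite tens_comp_l, tens_comp_r, !tensm_assoc, !comp_assoc by ty. f_equal.
      transitivity (((Y ⊗ D)%ob ⊗ sym D Y') ∘ (sym D Y ⊗ (D ⊗ Y')%ob)); [f_equal; flat|].
      transitivity ((sym D Y ⊗ (Y' ⊗ D)%ob) ∘ ((D ⊗ Y)%ob ⊗ sym D Y')); [|f_equal; flat].
      now rewrite tens_merge, tens_merge' by ty. }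
    rewrite (comp_tail m), <- comp_assoc by ty.
    transitivity ((f ⊗ g ⊗ k) ∘ ((D ⊗ sym D Y ⊗ Y' ⊗ D ⊗ Y'') ∘
      ((delta ⊗ Y ⊗ Y' ⊗ D ⊗ Y'') ∘ ((D ⊗ sym D (Y ⊗ Y') ⊗ Y'') ∘ (delta ⊗ Y ⊗ Y' ⊗ Y''))))).
    + do 2 f_equal. rewrite (comp_tail n) by ty. rewrite <- comp_assoc by ty. f_equal.
      rewrite <- !tens_comp_r by ty. reflexivity.
    + transitivity ((((f ⊗ g) ∘ ((D ⊗ sym D Y ⊗ Y') ∘ (delta ⊗ Y ⊗ Y'))) ⊗ k) ∘
       (((D ⊗ Y ⊗ Y')%ob ⊗ (D ⊗ Y'')%ob) ∘ ((D ⊗ sym D (Y ⊗ Y') ⊗ Y'') ∘ (delta ⊗ Y ⊗ Y' ⊗ Y'')))).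
      2:{ f_equal. rewrite (tensm_id (D ⊗ Y ⊗ Y')), id_l by ty. f_equal; flat. }
      symmetry.
      rewrite comp_assoc, <- tensm_comp by ty.
      rewrite id_r, id_r by ty.
      rewrite <- (@id_r _ (D ⊗ Y'')%ob k) at 1 by ty.
      rewrite tensm_comp, (tens_comp_r (D ⊗ Y'')) by ty.
      rewrite <- !tensm_id, !tensm_assoc, <- !comp_assoc by ty. reflexivity.
Qed.

(** Naturality in the linear variables Y and Y'. *)
Lemma pair_precomp Y Y' X X' y y' f g :
  y ∈ Y ⟶ X -> y' ∈ Y' ⟶ X' -> dom f = (D ⊗ X)%ob -> dom g = (D ⊗ X')%ob ->
  pairing X X' f g ∘ (D ⊗ y ⊗ y') = pairing Y Y' (f ∘ (D ⊗ y)) (g ∘ (D ⊗ y')).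
Proof.
  intros hy hy' hf hg; unfold pairing.
  rewrite tensm_comp, <- !comp_assoc by ty; f_equal.
  transitivity ((D ⊗ sym D X ⊗ X') ∘ ((D ⊗ (D ⊗ y) ⊗ y') ∘ (delta ⊗ Y ⊗ Y'))).
  - rewrite tens3_comp by ty. f_equal.
    transitivity (((D ⊗ D)%ob ⊗ y ⊗ y') ∘ (delta ⊗ Y ⊗ Y')); [|f_equal; flat].
    rewrite tens3_comp by ty. now rewrite !id_l, !id_r by ty.
  - rewrite comp_assoc, tens3_comp, (sym_natural_r D hy) by ty.
    transitivity ((D ⊗ (y ⊗ D) ⊗ y') ∘ ((D ⊗ sym D Y ⊗ Y') ∘ (delta ⊗ Y ⊗ Y'))); [|f_equal; flat].
    symmetry; rewrite (comp_assoc (h := D ⊗ (y ⊗ D) ⊗ y')), tens3_comp by ty.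
    f_equal. f_equal. now rewrite !id_l, !id_r by ty.
Qed.

End Pairing.

Ltac ty_hook ::=
  match goal with
  | h : ?dd ∈ ?D ⟶ _ |- context [dom (pairing ?D ?dd ?Y ?Y' ?f ?g)] =>
      rewrite (@pair_dom _ D dd h Y Y' f g) by ty
  | h : ?dd ∈ ?D ⟶ _ |- context [cod (pairing ?D ?dd ?Y ?Y' ?f ?g)] =>
      rewrite (@pair_cod _ D dd h Y Y' f g) by ty
  end.

Section Elements.
Variable C : strictSymMonCat.
Implicit Types (X Y Z : ob C) (a b f g h k t : mor C).
Variables (D : ob C) (eps delta : mor C).
Hypothesis coalg_D : is_coalgebra D eps delta.
Hypothesis cocomm_D : sym D D ∘ delta = delta.
Let delta_D : delta ∈ D ⟶ D ⊗ D := delta_hom coalg_D.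
Let eps_D : eps ∈ D ⟶ unit_ob := eps_hom coalg_D.
Local Notation K := unit_ob.
Local Notation pair := (pairing D delta).

Lemma pair_point_l Y a f : dom a = D -> dom f = (D ⊗ Y)%ob ->
  pair K Y a f = (a ⊗ f) ∘ (delta ⊗ Y).
Proof.
  intros ha hf; unfold pairing; rewrite sym_unit_r, !tensm_unitr; f_equal.
  rewrite !tensm_id, id_l by ty; reflexivity.
Qed.

Lemma pair_points a b : dom a = D -> dom b = D -> pair K K a b = (a ⊗ b) ∘ delta.
Proof. intros ha hb; rewrite pair_point_l, tensm_unitr by ty; reflexivity. Qed.

(** The instances of associativity with at most one linear variable; the letters
    p and v tell which arguments are points and which one carries Y. *)
Lemma pair_ppp a b c : dom a = D -> dom b = D -> dom c = D ->
  pair K K a (pair K K b c) = pair K K (pair K K a b) c.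
Proof.
  intros; pose proof (@pair_assoc C D delta delta_D K K K a b c (delta_assoc coalg_D)) as e.
  rewrite !tens_unitr in e; apply e; ty.
Qed.

Lemma pair_ppv Y a b v : dom a = D -> dom b = D -> dom v = (D ⊗ Y)%ob ->
  pair K Y a (pair K Y b v) = pair K Y (pair K K a b) v.
Proof.
  intros; pose proof (@pair_assoc C D delta delta_D K K Y a b v (delta_assoc coalg_D)) as e.
  rewrite !tens_unitr, tens_unitl in e; apply e; ty.
Qed.

Lemma pair_pvp Y a v b : dom a = D -> dom b = D -> dom v = (D ⊗ Y)%ob ->
  pair K Y a (pair Y K v b) = pair Y K (pair K Y a v) b.
Proof.
  intros; pose proof (@pair_assoc C D delta delta_D K Y K a v b (delta_assoc coalg_D)) as e.
  rewrite !tens_unitr, tens_unitl in e; apply e; ty.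
Qed.

Lemma pair_vpp Y v a b : dom a = D -> dom b = D -> dom v = (D ⊗ Y)%ob ->
  pair Y K v (pair K K a b) = pair Y K (pair Y K v a) b.
Proof.
  intros; pose proof (@pair_assoc C D delta delta_D Y K K v a b (delta_assoc coalg_D)) as e.
  rewrite !tens_unitr in e; apply e; ty.
Qed.

(** A point carries no linear variable, so by cocommutativity nothing remembers
    on which side of v it was evaluated.  Most
    permutations of factors disappear from the computations for this reason. *)
Lemma pair_swap Y X X' a v : a ∈ D ⟶ X -> v ∈ D ⊗ Y ⟶ X' ->
  sym X X' ∘ pair K Y a v = pair Y K v a.
Proof.
  intros ha hv; rewrite pair_point_l by ty.
  rewrite comp_assoc, (sym_natural ha hv) by ty.
  unfold pairing; rewrite <- comp_assoc, !tensm_unitr by ty; f_equal.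
  rewrite sym_hexagon, <- comp_assoc by ty; f_equal.
  now rewrite <- tens_comp_r, cocomm_D by ty.
Qed.

Lemma pair_const_r a x : dom a = D -> x ∈ K ⟶ cod x ->
  pair K K a (x ∘ eps) = (cod a ⊗ x) ∘ a.
Proof.
  intros ha hx; rewrite pair_points by ty.
  rewrite <- (@id_l _ (cod a) a) at 1 by ty.
  rewrite tensm_comp, <- (tens_merge (f := a) (g := eps) (A := D) (B := K)) by ty.
  rewrite <- !comp_assoc, (delta_epsr coalg_D), tensm_unitr by ty.
  f_equal; apply id_r; ty.
Qed.

Lemma pair_const_l a x : dom a = D -> x ∈ K ⟶ cod x ->
  pair K K (x ∘ eps) a = (x ⊗ cod a) ∘ a.
Proof.
  intros ha hx; rewrite pair_points by ty.
  rewrite <- (@id_l _ (cod a) a) at 1 by ty.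
  rewrite tensm_comp, <- (tens_merge' (f := eps) (g := a) (A := K) (B := D)) by ty.
  rewrite <- !comp_assoc, (delta_epsl coalg_D), tensm_unitl by ty.
  f_equal; apply id_r; ty.
Qed.

End Elements.

(** * Convolution *)
(** xy and xz are idempotents that absorb each other, so they are equal when they
    commute; the same holds for yx and zx. *)
Lemma generalized_inverse_unique (S : Type) (m : S -> S -> S) (x y z : S) :
  (forall a b c, m a (m b c) = m (m a b) c) ->
  m (m x y) x = x -> m (m y x) y = y -> m (m x z) x = x -> m (m z x) z = z ->
  m (m x y) (m x z) = m (m x z) (m x y) ->
  m (m y x) (m z x) = m (m z x) (m y x) -> y = z.
Proof.
  intros as_ xyx yxy xzx zxz c1 c2.
  assert (e1 : m x y = m x z).
  { rewrite <- xzx at 1. rewrite <- as_, <- c1, as_, xyx. reflexivity. }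
  assert (e2 : m y x = m z x).
  { rewrite <- xzx at 1. rewrite <- as_, as_, c2, <- as_, (as_ x), xyx. reflexivity. }
  rewrite <- yxy, e2, <- as_, e1, as_, zxz; reflexivity.
Qed.

(** Used in H⊗H with j = δ(1), l = e⊗1, r = 1⊗e, x = e⊗e and d = δ(e). *)
Lemma commute_of_common_factor (S : Type) (m : S -> S -> S) (j l r x d : S) :
  (forall a b c, m a (m b c) = m (m a b) c) ->
  d = m l j -> d = m j l -> d = m r j -> d = m j r -> x = m l r -> x = m r l ->
  m d x = m x d.
Proof.
  intros as_ d1 d2 d3 d4 x1 x2.
  assert (jl : m j l = m l j) by congruence.
  assert (jr : m j r = m r j) by congruence.
  assert (rl : m r l = m l r) by congruence.
  rewrite d1, x1, <- !as_.
  now rewrite (as_ j l r), jl, <- as_, jr, (as_ r l j), rl, <- as_.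
Qed.

Lemma sig_eq (T : Type) (P : T -> Prop) (x y : {x | P x}) :
  proj1_sig x = proj1_sig y -> x = y.
Proof. destruct x, y; apply subset_eq_compat. Qed.

Section Convolution.
Variable C : strictSymMonCat.
Implicit Types (X Y Z : ob C) (a b c f g h k t : mor C).
Variables (D : ob C) (eps delta : mor C).
Hypothesis coalg_D : is_coalgebra D eps delta.
Hypothesis cocomm_D : sym D D ∘ delta = delta.
Let delta_D : delta ∈ D ⟶ D ⊗ D := delta_hom coalg_D.
Let eps_D : eps ∈ D ⟶ unit_ob := eps_hom coalg_D.
Local Notation K := unit_ob.
Local Notation pair := (pairing D delta).

Section Alg.
Variable A : algebra C.

Lemma conv_pair a b : dom a = D -> dom b = D -> cod a = A -> cod b = A ->
  conv A delta a b = mu A ∘ pair K K a b.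
Proof. intros; unfold conv; now rewrite (pair_points coalg_D), comp_assoc by ty. Qed.

Lemma conv_hom a b : a ∈ D ⟶ A -> b ∈ D ⟶ A -> conv A delta a b ∈ D ⟶ A.
Proof. intros; unfold conv; ty. Qed.

Lemma conv_assoc a b c : a ∈ D ⟶ A -> b ∈ D ⟶ A -> c ∈ D ⟶ A ->
  conv A delta a (conv A delta b c) = conv A delta (conv A delta a b) c.
Proof.
  intros ha hb hc; pose proof (conv_hom ha hb); pose proof (conv_hom hb hc).
  rewrite !conv_pair by ty.
  rewrite <- (@id_l _ A a) at 1 by ty. rewrite <- (@id_l _ A c) at 2 by ty.
  rewrite <- !(tens_pair delta_D) by ty.
  rewrite !comp_assoc, (pair_ppp coalg_D), mu_assoc by ty; reflexivity.
Qed.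

Lemma conv_unitl a : a ∈ D ⟶ A -> conv A delta (eta A ∘ eps) a = a.
Proof.
  intros ha; rewrite conv_pair, (pair_const_l coalg_D) by ty.
  rewrite (hom_cod ha), comp_assoc, mu_etal by ty; apply id_l; ty.
Qed.

Lemma conv_unitr a : a ∈ D ⟶ A -> conv A delta a (eta A ∘ eps) = a.
Proof.
  intros ha; rewrite conv_pair, (pair_const_r coalg_D) by ty.
  rewrite (hom_cod ha), comp_assoc, mu_etar by ty; apply id_l; ty.
Qed.

(** Bundled with its typing, so that statements about semigroups apply. *)
Definition point := {a : mor C | a ∈ D ⟶ A}.
Definition point_mul (x y : point) : point :=
  exist _ (conv A delta (proj1_sig x) (proj1_sig y)) (conv_hom (proj2_sig x) (proj2_sig y)).
Lemma point_mul_assoc x y z :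
  point_mul x (point_mul y z) = point_mul (point_mul x y) z.
Proof. apply sig_eq, conv_assoc; apply proj2_sig. Qed.
End Alg.

(** Only the middle factors b and c cross, and points cross freely by
    [pair_swap]. *)
Lemma pair_interchange a b c d X Y :
  dom a = D -> b ∈ D ⟶ X -> c ∈ D ⟶ Y -> dom d = D ->
  (cod a ⊗ sym X Y ⊗ cod d) ∘ pair K K (pair K K a b) (pair K K c d)
  = pair K K (pair K K a c) (pair K K b d).
Proof.
  intros ha hb hc hd.
  assert (hb' : b ∈ D ⊗ K ⟶ X) by (split; ty).
  rewrite <- (pair_ppp coalg_D), (pair_ppp coalg_D (a := b)) by ty.
  rewrite <- tensm_assoc, !(tens_pair delta_D), !id_l by ty.
  assert (hc' : c ∈ D ⊗ K ⟶ Y) by (split; ty).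
  rewrite (pair_swap coalg_D cocomm_D hb hc').
  now rewrite <- (pair_ppp coalg_D), (pair_ppp coalg_D (a := a)) by ty.
Qed.

Lemma conv_tens (A A' : algebra C) a b c d :
  a ∈ D ⟶ A -> b ∈ D ⟶ A' -> c ∈ D ⟶ A -> d ∈ D ⟶ A' ->
  conv (tens_algebra A A') delta (pair K K a b) (pair K K c d)
  = pair K K (conv A delta a c) (conv A' delta b d).
Proof.
  intros ha hb hc hd; rewrite !conv_pair by (simpl; ty); simpl; unfold tens_mu.
  rewrite <- comp_assoc by ty.
  pose proof (@pair_interchange a b c d A' A (hom_dom ha) hb hc (hom_dom hd)) as e.
  rewrite (hom_cod ha), (hom_cod hd) in e; rewrite e.
  now rewrite (tens_pair delta_D) by ty.
Qed.
End Convolution.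

Ltac ty_hook ::=
  match goal with
  | h : ?dd ∈ ?D ⟶ _ |- context [dom (pairing ?D ?dd ?Y ?Y' ?f ?g)] =>
      rewrite (@pair_dom _ D dd h Y Y' f g) by ty
  | h : ?dd ∈ ?D ⟶ _ |- context [cod (pairing ?D ?dd ?Y ?Y' ?f ?g)] =>
      rewrite (@pair_cod _ D dd h Y Y' f g) by ty
  | h : is_coalgebra _ _ ?dd |- context [dom (conv ?A ?dd ?f ?g)] =>
      rewrite (hom_dom (@conv_hom _ _ _ dd h A f g ltac:(split; ty) ltac:(split; ty)))
  | h : is_coalgebra _ _ ?dd |- context [cod (conv ?A ?dd ?f ?g)] =>
      rewrite (hom_cod (@conv_hom _ _ _ dd h A f g ltac:(split; ty) ltac:(split; ty)))
  | |- _ => progress simpl alg_ob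
  end.

Section TargetMap.
Variable C : strictSymMonCat.
Variable H : ob C.

(** In elements, with J = Σ 1₁⊗1₂ and κ(h) = Σ ν(1₁,h) 1₂, the hypothesis turns
    δ(κ(h)) = Σ ν(1₁,h) 1₂⊗1₃ into Σ ν(1₁,h) ξ(1₂,1'₁)⊗1'₂ = Σ ξ(κ(h),1'₁)⊗1'₂.
    Target and source maps are both of the form κ, and ξ may be the product or
    its opposite, so one computation yields four formulas. *)
Lemma comult_of_counital_map (J nu xi delta : mor C) :
  J ∈ unit_ob ⟶ H ⊗ H -> nu ∈ H ⊗ H ⟶ unit_ob -> xi ∈ H ⊗ H ⟶ H ->
  delta ∈ H ⟶ H ⊗ H ->
  (H ⊗ delta) ∘ J = (H ⊗ xi ⊗ H) ∘ (J ⊗ J) ->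
  delta ∘ ((nu ⊗ H) ∘ ((H ⊗ sym H H) ∘ (J ⊗ H)))
  = (xi ⊗ H) ∘ (((nu ⊗ H) ∘ ((H ⊗ sym H H) ∘ (J ⊗ H))) ⊗ J).
Proof.
  intros hJ hnu hxi hd e.
  (* [s1] and [s2] push δ onto J, the hypothesis splits it into two copies of J,
     and [s3] and [s4] move ν away from the second copy. *)
  assert (s1 : delta ∘ (nu ⊗ H) = (nu ⊗ H ⊗ H) ∘ (H ⊗ H ⊗ delta)).
  { rewrite <- (tensm_assoc nu), (tensm_id H H), tens_merge by ty.
    transitivity ((unit_ob ⊗ delta) ∘ (nu ⊗ H)); [now rewrite tensm_unitl|].
    now rewrite tens_merge' by ty. }
  rewrite comp_assoc, s1, <- comp_assoc by ty.
  assert (s2 : (H ⊗ H ⊗ delta) ∘ (H ⊗ sym H H) = (H ⊗ sym (H ⊗ H) H) ∘ (H ⊗ delta ⊗ H)).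
  { rewrite <- !tensm_assoc, <- !tens_comp_l by ty. now rewrite (sym_natural_l H hd). }
  rewrite (comp_tail s2), <- comp_assoc by ty.
  rewrite <- tens_comp_r, e, tens_comp_r by ty.
  assert (s3 : (H ⊗ sym (H ⊗ H) H) ∘ (H ⊗ xi ⊗ H ⊗ H)
    = (H ⊗ H ⊗ xi ⊗ H) ∘ ((H ⊗ sym H H ⊗ H ⊗ H) ∘ (H ⊗ H ⊗ sym (H ⊗ H) H))).
  { transitivity (H ⊗ (sym (H ⊗ H) H ∘ ((xi ⊗ H) ⊗ H))); [rewrite tens_comp_l by ty; f_equal; flat|].
    rewrite (@sym_natural_l C (H ⊗ H ⊗ H)%ob (H ⊗ H)%ob H (xi ⊗ H)) by ty.
    rewrite <- (tens_assoc H H H), (sym_hexagon_l H (H ⊗ H)).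
    rewrite !tens_comp_l by ty. f_equal; [flat|]. f_equal; flat. }
  rewrite (comp_tail s3), <- !comp_assoc by ty.
  assert (s4 : (H ⊗ H ⊗ sym (H ⊗ H) H) ∘ (J ⊗ J ⊗ H) = J ⊗ H ⊗ J).
  { transitivity (((H ⊗ H)%ob ⊗ sym (H ⊗ H) H) ∘ (J ⊗ (J ⊗ H))); [f_equal; flat|].
    rewrite <- tensm_comp, id_l by ty.
    rewrite (sym_natural_l H hJ), sym_unit_l, id_r, tensm_assoc by ty; reflexivity. }
  rewrite s4.
  transitivity ((xi ⊗ H) ∘ (((nu ⊗ H) ⊗ (H ⊗ H)%ob) ∘ (((H ⊗ sym H H) ⊗ (H ⊗ H)%ob) ∘ ((J ⊗ H) ⊗ J)))).
  - rewrite comp_assoc, (comp_assoc (h := xi ⊗ H)) by ty.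
    f_equal; [|f_equal; flat].
    transitivity ((nu ⊗ (H ⊗ H)%ob) ∘ ((H ⊗ H)%ob ⊗ (xi ⊗ H))); [f_equal; flat|].
    transitivity ((unit_ob ⊗ (xi ⊗ H)) ∘ (nu ⊗ (H ⊗ H ⊗ H)%ob)).
    + now rewrite tens_merge, tens_merge' by ty.
    + rewrite tensm_unitl; f_equal; flat.
  - f_equal; rewrite <- !tensm_comp by ty. f_equal. rewrite !id_l by ty; reflexivity.
Qed.

End TargetMap.

Section TensMu.
Variable C : strictSymMonCat.
Variables A B : algebra C.

Lemma tens_mu_actl : tens_mu A B ∘ ((A ⊗ eta B) ⊗ (A ⊗ B)%ob) = mu A ⊗ B.
Proof.
  unfold tens_mu.
  transitivity ((mu A ⊗ mu B) ∘ ((A ⊗ sym B A ⊗ B) ∘ (A ⊗ (eta B ⊗ A) ⊗ B)));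
    [rewrite comp_assoc by ty; f_equal; flat|].
  rewrite tens3_comp by ty.
  rewrite (sym_natural_l A (eta_hom B)), sym_unit_l, !id_l, id_r by ty.
  transitivity ((mu A ⊗ mu B) ∘ ((A ⊗ A)%ob ⊗ (eta B ⊗ B))); [f_equal; flat|].
  rewrite <- tensm_comp, mu_etal, id_r by ty; reflexivity.
Qed.

Lemma tens_mu_actr : tens_mu A B ∘ ((A ⊗ B)%ob ⊗ (A ⊗ eta B)) = (mu A ⊗ B) ∘ (A ⊗ sym B A).
Proof.
  unfold tens_mu.
  transitivity ((mu A ⊗ mu B) ∘ (((A ⊗ sym B A) ⊗ B) ∘ ((A ⊗ B ⊗ A)%ob ⊗ eta B)));
    [rewrite comp_assoc by ty; f_equal; flat|].
  rewrite tens_merge by ty.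
  transitivity ((mu A ⊗ mu B) ∘ ((A ⊗ A)%ob ⊗ (B ⊗ eta B) ∘ (A ⊗ sym B A))).
  - f_equal. transitivity (((A ⊗ A ⊗ B)%ob ⊗ eta B) ∘ ((A ⊗ sym B A) ⊗ unit_ob));
      [now rewrite tens_merge' by ty|rewrite tensm_unitr; f_equal; flat].
  - rewrite comp_assoc, <- tensm_comp, mu_etar, id_r by ty; reflexivity.
Qed.

Lemma tens_mu_actr' : tens_mu A B ∘ ((A ⊗ B)%ob ⊗ (eta A ⊗ B)) = A ⊗ mu B.
Proof.
  unfold tens_mu.
  transitivity ((mu A ⊗ mu B) ∘ ((A ⊗ sym B A ⊗ B) ∘ (A ⊗ (B ⊗ eta A) ⊗ B)));
    [rewrite comp_assoc by ty; f_equal; flat|].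
  rewrite tens3_comp by ty.
  rewrite (sym_natural_r B (eta_hom A)), sym_unit_r, !id_l, id_r by ty.
  transitivity ((mu A ⊗ mu B) ∘ ((A ⊗ eta A) ⊗ (B ⊗ B)%ob)); [f_equal; flat|].
  rewrite <- tensm_comp, mu_etar, id_r by ty; reflexivity.
Qed.

Lemma tens_mu_sym (H : algebra C) :
  sym H H ∘ tens_mu H H = tens_mu H H ∘ (sym H H ⊗ sym H H).
Proof.
  unfold tens_mu.
  rewrite comp_assoc, (sym_natural (mu_hom H) (mu_hom H)), <- !comp_assoc by ty.
  now rewrite sym_interchange.
Qed.
End TensMu.

Section ConvTens.
Variable C : strictSymMonCat.
Implicit Types (X Y Z : ob C) (a b c f g h k t : mor C).
Variables (D : ob C) (eps delta : mor C).
Hypothesis coalg_D : is_coalgebra D eps delta.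
Hypothesis cocomm_D : sym D D ∘ delta = delta.
Let delta_D : delta ∈ D ⟶ D ⊗ D := delta_hom coalg_D.
Let eps_D : eps ∈ D ⟶ unit_ob := eps_hom coalg_D.
Local Notation K := unit_ob.
Local Notation pair := (pairing D delta).
Variables A B : algebra C.
Local Notation AB := (tens_algebra A B).

(** Convolution in A⊗B with a⊗1 or 1⊗b acts on one tensor factor only. *)
Lemma conv_tens_actl a x : a ∈ D ⟶ A -> x ∈ D ⟶ A ⊗ B ->
  conv AB delta (pair K K a (eta B ∘ eps)) x = (mu A ⊗ B) ∘ pair K K a x.
Proof.
  intros ha hx; rewrite (conv_pair coalg_D) by ty; simpl.
  rewrite (pair_const_r coalg_D), (hom_cod ha) by ty.
  rewrite <- (@id_l _ (A ⊗ B)%ob x) at 1 by ty.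
  rewrite <- (tens_pair delta_D) by ty.
  rewrite comp_assoc, tens_mu_actl by (unfold tens_mu; ty); reflexivity.
Qed.

Lemma conv_tens_actr a x : a ∈ D ⟶ A -> x ∈ D ⟶ A ⊗ B ->
  conv AB delta x (pair K K a (eta B ∘ eps))
  = (mu A ⊗ B) ∘ ((A ⊗ sym B A) ∘ pair K K x a).
Proof.
  intros ha hx; rewrite (conv_pair coalg_D) by ty; simpl.
  rewrite (pair_const_r coalg_D), (hom_cod ha) by ty.
  rewrite <- (@id_l _ (A ⊗ B)%ob x) at 1 by ty.
  rewrite <- (tens_pair delta_D) by ty.
  rewrite comp_assoc, tens_mu_actr, <- comp_assoc by (unfold tens_mu; ty); reflexivity.
Qed.

Lemma conv_tens_actr' b x : b ∈ D ⟶ B -> x ∈ D ⟶ A ⊗ B ->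
  conv AB delta x (pair K K (eta A ∘ eps) b) = (A ⊗ mu B) ∘ pair K K x b.
Proof.
  intros ha hx; rewrite (conv_pair coalg_D) by ty; simpl.
  rewrite (pair_const_l coalg_D), (hom_cod ha) by ty.
  rewrite <- (@id_l _ (A ⊗ B)%ob x) at 1 by ty.
  rewrite <- (tens_pair delta_D) by ty.
  rewrite comp_assoc, tens_mu_actr' by (unfold tens_mu; ty); reflexivity.
Qed.
End ConvTens.

(** * Tensor products of coalgebras *)
Ltac swap_units := try ty; rewrite ?sym_unit_r, ?sym_unit_l; f_equal; ob_norm; reflexivity.

Section TensorCoalgebra.
Variable C : strictSymMonCat.
Variables (D E : ob C) (epsD deltaD epsE deltaE : mor C).
Hypothesis coalg_D : is_coalgebra D epsD deltaD.
Hypothesis coalg_E : is_coalgebra E epsE deltaE.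
Let hdD : deltaD ∈ D ⟶ D ⊗ D := delta_hom coalg_D.
Let hdE : deltaE ∈ E ⟶ E ⊗ E := delta_hom coalg_E.
Let heD : epsD ∈ D ⟶ unit_ob := eps_hom coalg_D.
Let heE : epsE ∈ E ⟶ unit_ob := eps_hom coalg_E.
Local Notation dDE := (delta_tens D E deltaD deltaE).
Local Notation DE := (D ⊗ E)%ob.
Local Notation K := unit_ob.
Local Notation pair := (pairing D deltaD).

(** E is treated as a linear variable, which is then copied by its own
    coproduct; coassociativity thus follows from [pair_assoc]. *)
Lemma delta_tens_pair : dDE = pair E E (idm DE) (idm DE) ∘ (D ⊗ deltaE).
Proof.
  unfold delta_tens, pairing; rewrite (tensm_id DE DE), id_l, <- comp_assoc by ty.
  f_equal. transitivity ((deltaD ⊗ (E ⊗ E)%ob) ∘ (D ⊗ deltaE)); [|f_equal; flat].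
  now rewrite tens_merge by ty.
Qed.

Lemma delta_tens_assoc : (dDE ⊗ DE) ∘ dDE = (DE ⊗ dDE) ∘ dDE.
Proof.
  assert (h : pair E E (idm DE) (idm DE) ∈ D ⊗ E ⊗ E ⟶ D ⊗ E ⊗ (D ⊗ E)) by (split; ty).
  rewrite delta_tens_pair at 2 4; rewrite !comp_assoc by (unfold delta_tens; ty).
  rewrite !(tens_pair hdD) by (unfold delta_tens; ty).
  rewrite !id_r by (unfold delta_tens; ty); rewrite delta_tens_pair.
  transitivity (pair (E ⊗ E) E (pair E E DE DE) DE ∘ ((D ⊗ deltaE ⊗ E) ∘ (D ⊗ deltaE))).
  - rewrite comp_assoc, (pair_precomp hdD (Y := E) (Y' := E)) by ty.
    rewrite tensm_id, (id_l (f := idm DE)) by ty; reflexivity.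
  - transitivity (pair E (E ⊗ E) DE (pair E E DE DE) ∘ ((D ⊗ E ⊗ deltaE) ∘ (D ⊗ deltaE))).
    + rewrite (pair_assoc hdD) by (try exact (delta_assoc coalg_D); ty).
      f_equal. rewrite <- !tensm_assoc, <- !tens_comp_l, (delta_assoc coalg_E) by ty; reflexivity.
    + rewrite comp_assoc, (pair_precomp hdD (Y := E) (Y' := E)) by ty.
      rewrite tensm_id, (id_l (f := idm DE)) by ty; reflexivity.
Qed.

(** The swap in the coproduct of D⊗E disappears when it meets values one of which
    lies in the unit object: then b and c commute past each other strictly.  All
    counit and projection identities are of this form. *)
Lemma tens4_delta_tens a b c d Xa Xb Xc Xd :
  a ∈ D ⟶ Xa -> b ∈ E ⟶ Xb -> c ∈ D ⟶ Xc -> d ∈ E ⟶ Xd ->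
  sym Xc Xb = idm (Xc ⊗ Xb) -> (Xb ⊗ Xc = Xc ⊗ Xb)%ob ->
  (a ⊗ b ⊗ c ⊗ d) ∘ dDE = (((a ⊗ c) ∘ deltaD) ⊗ ((b ⊗ d) ∘ deltaE)).
Proof.
  intros ha hb hc hd e e'.
  unfold delta_tens; rewrite <- (tensm_assoc a), comp_assoc by ty.
  rewrite tens3_comp, <- (sym_natural hc hb), e by ty.
  rewrite (id_l (f := c ⊗ b)), !id_r by ty.
  rewrite tensm_assoc, <- tensm_assoc, <- tensm_comp by ty; reflexivity.
Qed.

Lemma tens_is_coalgebra : is_coalgebra DE (epsD ⊗ epsE) dDE.
Proof.
  split.
  - ty.
  - unfold delta_tens; ty.
  - rewrite <- (tensm_id D E), tensm_assoc.
    rewrite (@tens4_delta_tens epsD epsE (idm D) (idm E) K K D E) by swap_units.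
    now rewrite (delta_epsl coalg_D), (delta_epsl coalg_E), tensm_id.
  - rewrite <- (tensm_id D E), tensm_assoc.
    rewrite (@tens4_delta_tens (idm D) (idm E) epsD epsE D E K K) by swap_units.
    now rewrite (delta_epsr coalg_D), (delta_epsr coalg_E), tensm_id.
  - exact delta_tens_assoc.
Qed.

Definition proj_l : mor C := D ⊗ epsE.
Definition proj_r : mor C := epsD ⊗ E.

Lemma proj_l_hom : proj_l ∈ DE ⟶ D.
Proof. unfold proj_l; ty. Qed.
Lemma proj_r_hom : proj_r ∈ DE ⟶ E.
Proof. unfold proj_r; ty. Qed.

Lemma proj_pair : (proj_l ⊗ proj_r) ∘ dDE = idm DE.
Proof.
  unfold proj_l, proj_r; rewrite tensm_assoc.
  rewrite (@tens4_delta_tens (idm D) epsE epsD (idm E) D K K E) by swap_units.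
  now rewrite (delta_epsr coalg_D), (delta_epsl coalg_E), tensm_id.
Qed.

Lemma proj_l_comult : (proj_l ⊗ proj_l) ∘ dDE = deltaD ∘ proj_l.
Proof.
  unfold proj_l; rewrite tensm_assoc.
  rewrite (@tens4_delta_tens (idm D) epsE (idm D) epsE D K D K) by swap_units.
  rewrite tensm_id, id_l by ty.
  rewrite <- (tens_merge' (f := epsE) (g := epsE) (A := K) (B := E)) by ty.
  rewrite <- comp_assoc, (delta_epsl coalg_E), tensm_unitl, id_r by ty.
  rewrite <- (tensm_unitr deltaD) at 2; now rewrite tens_merge by ty.
Qed.

Lemma proj_r_comult : (proj_r ⊗ proj_r) ∘ dDE = deltaE ∘ proj_r.
Proof.
  unfold proj_r; rewrite tensm_assoc.
  rewrite (@tens4_delta_tens epsD (idm E) epsD (idm E) K E K E) by swap_units.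
  rewrite tensm_id, (id_l (f := deltaE)) by ty.
  rewrite <- (tens_merge' (f := epsD) (g := epsD) (A := K) (B := D)) by ty.
  rewrite <- comp_assoc, (delta_epsl coalg_D), tensm_unitl, id_r by ty.
  rewrite <- (tensm_unitl deltaE) at 2; now rewrite tens_merge' by ty.
Qed.

Lemma tens_cocommutative :
  sym D D ∘ deltaD = deltaD -> sym E E ∘ deltaE = deltaE -> sym DE DE ∘ dDE = dDE.
Proof.
  intros cD cE; unfold delta_tens.
  rewrite comp_assoc, sym_interchange, <- comp_assoc, <- tensm_comp, cD, cE by ty; reflexivity.
Qed.
End TensorCoalgebra.

(** * Cocommutative weak Hopf algebras *)
Section CocommWeakHopf.
Variable C : strictSymMonCat.
Variable H : weakHopf C.
Hypothesis Hcocomm : cocommutative H.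
Let wh := wh_axioms H.
Let coalg_H : is_coalgebra H (counit H) (comult H) := wh_coalgebra wh.
Let delta_H : comult H ∈ H ⟶ H ⊗ H := delta_hom coalg_H.
Let eps_H : counit H ∈ H ⟶ unit_ob := eps_hom coalg_H.
Let lam_H : antipode H ∈ H ⟶ H := wh_antipode_hom wh.
Local Notation K := unit_ob.
Local Notation J := (comult H ∘ eta H).
Local Notation HH := (tens_algebra H H).

Definition PiR : mor C := source_map H (counit H) (comult H).

Lemma PiL_hom : PiL H ∈ H ⟶ H.
Proof. unfold PiL, target_map; ty. Qed.
Lemma PiR_hom : PiR ∈ H ⟶ H.
Proof. unfold PiR, source_map; ty. Qed.

Lemma sym_J : sym H H ∘ J = J.
Proof. now rewrite comp_assoc, Hcocomm by ty. Qed.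

Lemma comult_J_l : (H ⊗ comult H) ∘ J = (H ⊗ mu H ⊗ H) ∘ (J ⊗ J).
Proof. rewrite comp_assoc, <- (delta_assoc coalg_H) by ty; apply (wh_unit wh). Qed.
Lemma comult_J_r : (H ⊗ comult H) ∘ J = (H ⊗ (mu H ∘ sym H H) ⊗ H) ∘ (J ⊗ J).
Proof. rewrite comp_assoc, <- (delta_assoc coalg_H) by ty; apply (wh_unit_sym wh). Qed.

Lemma PiL_E : PiL H = ((counit H ∘ mu H) ⊗ H) ∘ ((H ⊗ sym H H) ∘ (J ⊗ H)).
Proof. unfold PiL, target_map; now rewrite comp_assoc by ty. Qed.

(** Both sides send h to Σ 1₁⊗h⊗1₂. *)
Lemma J_slide : (H ⊗ sym H H) ∘ (J ⊗ H) = (sym H H ⊗ H) ∘ (H ⊗ J).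
Proof.
  assert (hJ : J ∈ K ⟶ H ⊗ H) by ty.
  pose proof (sym_natural_l H hJ) as e; rewrite sym_unit_l, id_r in e by ty.
  rewrite <- e, sym_hexagon_l, <- comp_assoc, (comp_assoc (h := sym H H ⊗ H)) by ty.
  rewrite <- tens_comp_r, sym_inv, tensm_id, id_l by ty; reflexivity.
Qed.

(** As δ(1) is symmetric, the source map Σ 1₁ ε(h1₂) is Σ ε(h1₁)1₂: the target
    map of the opposite product. *)
Lemma PiR_E : PiR = ((counit H ∘ mu H ∘ sym H H) ⊗ H) ∘ ((H ⊗ sym H H) ∘ (J ⊗ H)).
Proof.
  assert (hn : counit H ∘ mu H ∈ H ⊗ H ⟶ K) by ty.
  rewrite J_slide, comp_assoc, <- tens_comp_r by ty.
  rewrite <- comp_assoc, sym_inv, (id_r (f := counit H ∘ mu H)) by ty.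
  pose proof (sym_natural_l H hn) as e; rewrite sym_unit_l, id_l in e by ty.
  rewrite e, sym_hexagon_l, <- !comp_assoc, <- tens_comp_l, sym_J by ty.
  unfold PiR, source_map; rewrite <- comp_assoc by ty; reflexivity.
Qed.

Lemma comult_PiL_l : comult H ∘ PiL H = (mu H ⊗ H) ∘ (PiL H ⊗ J).
Proof.
  rewrite PiL_E; apply comult_of_counital_map; try ty; exact comult_J_l.
Qed.
Lemma comult_PiL_r : comult H ∘ PiL H = ((mu H ∘ sym H H) ⊗ H) ∘ (PiL H ⊗ J).
Proof.
  rewrite PiL_E; apply comult_of_counital_map; try ty; exact comult_J_r.
Qed.
Lemma comult_PiR_l : comult H ∘ PiR = (mu H ⊗ H) ∘ (PiR ⊗ J).
Proof.
  rewrite PiR_E; apply comult_of_counital_map; try ty; exact comult_J_l.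
Qed.
Lemma comult_PiR_r : comult H ∘ PiR = ((mu H ∘ sym H H) ⊗ H) ∘ (PiR ⊗ J).
Proof.
  rewrite PiR_E; apply comult_of_counital_map; try ty; exact comult_J_r.
Qed.

Section Elements.
Variables (D : ob C) (eps delta : mor C).
Hypothesis coalg_D : is_coalgebra D eps delta.
Hypothesis cocomm_D : sym D D ∘ delta = delta.
Let delta_D : delta ∈ D ⟶ D ⊗ D := delta_hom coalg_D.
Let eps_D : eps ∈ D ⟶ unit_ob := eps_hom coalg_D.
Local Notation pp := (pairing D delta K K).
Local Notation one := (eta H ∘ eps).
Implicit Types a b e k : mor C.

Lemma comult_conv a b : a ∈ D ⟶ H -> b ∈ D ⟶ H ->
  comult H ∘ conv H delta a b = conv HH delta (comult H ∘ a) (comult H ∘ b).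
Proof.
  intros ha hb; rewrite !(conv_pair coalg_D), comp_assoc, (wh_mult wh) by ty.
  rewrite <- (tens_pair delta_D) by ty.
  unfold delta_tens; simpl; unfold tens_mu; rewrite !comp_assoc by ty; reflexivity.
Qed.

Lemma sym_conv x y : x ∈ D ⟶ H ⊗ H -> y ∈ D ⟶ H ⊗ H ->
  sym H H ∘ conv HH delta x y = conv HH delta (sym H H ∘ x) (sym H H ∘ y).
Proof.
  intros hx hy; rewrite !(conv_pair coalg_D) by ty; simpl.
  rewrite comp_assoc, tens_mu_sym by (unfold tens_mu; ty).
  rewrite <- comp_assoc, (tens_pair delta_D) by (unfold tens_mu; ty); reflexivity.
Qed.

Lemma sym_pp a b : a ∈ D ⟶ H -> b ∈ D ⟶ H -> sym H H ∘ pp a b = pp b a.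
Proof. intros ha hb; apply (pair_swap coalg_D cocomm_D); ty. Qed.

Lemma comult_one : comult H ∘ one = J ∘ eps.
Proof. apply comp_assoc; ty. Qed.

Lemma base_like_comp p a : p ∈ H ⟶ H -> a ∈ D ⟶ H ->
  comult H ∘ p = (mu H ⊗ H) ∘ (p ⊗ J) ->
  comult H ∘ p = ((mu H ∘ sym H H) ⊗ H) ∘ (p ⊗ J) ->
  comult H ∘ (p ∘ a) = conv HH delta (pp (p ∘ a) one) (J ∘ eps)
  /\ comult H ∘ (p ∘ a) = conv HH delta (J ∘ eps) (pp (p ∘ a) one).
Proof.
  intros hp ha el er.
  rewrite (conv_tens_actl coalg_D), (conv_tens_actr coalg_D) by ty.
  rewrite (pair_const_r coalg_D), (pair_const_l coalg_D) by ty.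
  rewrite (comp_assoc (h := comult H)) by ty.
  assert (hJ : J ∈ K ⟶ H ⊗ H) by ty.
  assert (es : cod (p ∘ a) = H) by ty. rewrite es.
  assert (pJ : p ⊗ J = (H ⊗ J) ∘ p).
  { rewrite <- (tensm_unitr p) at 2; now rewrite tens_merge' by ty. }
  split.
  - rewrite el, pJ, <- !comp_assoc by ty; reflexivity.
  - rewrite er, pJ, tens_comp_r by ty.
    rewrite (comp_assoc (h := H ⊗ sym H H)), J_slide, <- !comp_assoc by ty; reflexivity.
Qed.

(** δ(e) = (e⊗1)δ(1) = δ(1)(e⊗1): for D = K these are the elements of the base
    subalgebra, the common image of the target and source maps. *)
Definition base_like e :=
  comult H ∘ e = conv HH delta (pp e one) (J ∘ eps)
  /\ comult H ∘ e = conv HH delta (J ∘ eps) (pp e one).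

Lemma base_like_sym e : e ∈ D ⟶ H -> base_like e ->
  comult H ∘ e = conv HH delta (pp one e) (J ∘ eps)
  /\ comult H ∘ e = conv HH delta (J ∘ eps) (pp one e).
Proof.
  intros he [l r].
  assert (ec : comult H ∘ e = sym H H ∘ (comult H ∘ e))
    by now rewrite comp_assoc, Hcocomm by ty.
  assert (eJ : sym H H ∘ (J ∘ eps) = J ∘ eps) by now rewrite comp_assoc, sym_J by ty.
  split; rewrite ec, ?l.
  - rewrite sym_conv, eJ, sym_pp by ty; reflexivity.
  - rewrite <- l, r, sym_conv, eJ, sym_pp by ty; reflexivity.
Qed.

Lemma pp_split e a : e ∈ D ⟶ H -> a ∈ D ⟶ H ->
  pp e a = conv HH delta (pp e one) (pp one a).
Proof.
  intros he ha; rewrite (conv_tens coalg_D cocomm_D) by ty.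
  now rewrite (conv_unitl coalg_D), (conv_unitr coalg_D) by ty.
Qed.
Lemma pp_split' e a : e ∈ D ⟶ H -> a ∈ D ⟶ H ->
  pp e a = conv HH delta (pp one a) (pp e one).
Proof.
  intros he ha; rewrite (conv_tens coalg_D cocomm_D) by ty.
  now rewrite (conv_unitl coalg_D), (conv_unitr coalg_D) by ty.
Qed.

Local Notation pt := (@point C D HH).
(** δ(1) commutes with e⊗1 by hypothesis and with 1⊗e by symmetry, hence so does
    δ(e) = δ(1)(e⊗1) with their product e⊗e. *)
Lemma base_like_commute e : e ∈ D ⟶ H -> base_like e ->
  conv HH delta (comult H ∘ e) (pp e e) = conv HH delta (pp e e) (comult H ∘ e).
Proof.
  intros he hc; pose proof (base_like_sym he hc) as [l' r']; destruct hc as [l r].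
  assert (h1 : J ∘ eps ∈ D ⟶ HH) by ty.
  assert (h2 : pp e one ∈ D ⟶ HH) by ty.
  assert (h3 : pp one e ∈ D ⟶ HH) by ty.
  assert (h4 : pp e e ∈ D ⟶ HH) by ty.
  assert (h5 : comult H ∘ e ∈ D ⟶ HH) by ty.
  pose proof (@commute_of_common_factor pt (point_mul coalg_D (A := HH))
    (exist _ _ h1) (exist _ _ h2) (exist _ _ h3) (exist _ _ h4) (exist _ _ h5)) as c.
  refine (f_equal (@proj1_sig _ _) (c _ _ _ _ _ _ _));
    [intros; apply point_mul_assoc|..]; apply sig_eq; simpl; auto;
    [apply pp_split|apply pp_split']; ty.
Qed.
End Elements.

(** Σ Π(h₁)h₂ = h, because it is (ε⊗H) applied to
    δ(1)(h₁⊗h₂) = δ(1)δ(h) = δ(h). *)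
Lemma PiL_conv : conv H (comult H) (PiL H) (idm H) = idm H.
Proof.
  assert (e : PiL H = (counit H ⊗ H) ∘
    conv HH (comult H) (J ∘ counit H) (pairing H (comult H) K K (idm H) (eta H ∘ counit H))).
  { rewrite (conv_tens_actr coalg_H), (pair_const_l coalg_H), cod_idm by ty.
    rewrite (id_r (f := J ⊗ H)), PiL_E, (comp_assoc (h := counit H ⊗ H)), <- tens_comp_r by ty; reflexivity. }
  pose proof PiL_hom; rewrite (conv_pair coalg_H), e by ty.
  set (x := conv _ _ _ _).
  assert (hx : x ∈ H ⟶ H ⊗ H) by (unfold x; ty).
  assert (e1 : pairing H (comult H) K K ((counit H ⊗ H) ∘ x) H
    = (counit H ⊗ H ⊗ H) ∘ pairing H (comult H) K K x H)
    by now rewrite (tens_pair delta_H), id_l by ty.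
  rewrite e1, comp_assoc by ty.
  assert (e2 : mu H ∘ (counit H ⊗ H ⊗ H) = (counit H ⊗ H) ∘ (H ⊗ mu H)).
  { rewrite tens_merge by ty.
    transitivity ((K ⊗ mu H) ∘ (counit H ⊗ (H ⊗ H)%ob)); [rewrite tensm_unitl; f_equal; flat|].
    now rewrite tens_merge' by ty. }
  rewrite e2, <- comp_assoc by ty.
  rewrite <- (conv_tens_actr' coalg_H) by ty.
  unfold x; rewrite <- (conv_assoc coalg_H) by ty.
  rewrite <- (pp_split coalg_H Hcocomm) by ty.
  rewrite (pair_points coalg_H), tensm_id, id_l by ty.
  rewrite <- (comult_one coalg_H).
  rewrite <- (id_r (f := comult H) (A := H)) at 3 by ty.
  rewrite <- (comult_conv coalg_H), (conv_unitl coalg_H), id_r by ty.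
  apply (delta_epsl coalg_H).
Qed.

(** δλ and (λ⊗λ)δ are both generalized inverses of δ for convolution in H⊗H.
    Their products with δ are δΠ and (Π⊗Π)δ, and the source analogues, which
    commute by [base_like_commute]. *)
Lemma comult_antipode : comult H ∘ antipode H = (antipode H ⊗ antipode H) ∘ comult H.
Proof.
  pose proof (wh_antipodel wh) as al; fold (PiL H) in al.
  pose proof (wh_antipoder wh) as ar; fold PiR in ar.
  pose proof PiL_hom; pose proof PiR_hom.
  assert (hid : idm H ∈ H ⟶ H) by ty.
  assert (p : pairing H (comult H) K K H H = comult H)
    by (rewrite (pair_points coalg_H), tensm_id, id_l by ty; reflexivity).
  assert (q : pairing H (comult H) K K (antipode H) (antipode H) = (antipode H ⊗ antipode H) ∘ comult H)
    by (rewrite (pair_points coalg_H) by ty; reflexivity).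
  assert (cL : base_like H (counit H) (comult H) (PiL H)).
  { unfold base_like. rewrite <- (id_r (f := PiL H) (A := H)) by ty.
    apply (base_like_comp coalg_H); try ty; [apply comult_PiL_l|apply comult_PiL_r]. }
  assert (cR : base_like H (counit H) (comult H) PiR).
  { unfold base_like. rewrite <- (id_r (f := PiR) (A := H)) by ty.
    apply (base_like_comp coalg_H); try ty; [apply comult_PiR_l|apply comult_PiR_r]. }
  assert (h1 : comult H ∘ H ∈ H ⟶ HH) by ty.
  assert (h2 : comult H ∘ antipode H ∈ H ⟶ HH) by ty.
  assert (h3 : pairing H (comult H) K K (antipode H) (antipode H) ∈ H ⟶ HH) by ty.
  assert (p' : comult H ∘ H = pairing H (comult H) K K H H) by (rewrite p, id_r by ty; reflexivity).
  pose proof (@generalized_inverse_unique (@point C H HH) (point_mul coalg_H (A := HH))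
    (exist _ _ h1) (exist _ _ h2) (exist _ _ h3)) as u.
  rewrite <- q.
  refine (f_equal (@proj1_sig _ _) (u _ _ _ _ _ _ _));
    [intros; apply point_mul_assoc|..]; apply sig_eq; cbn [proj1_sig point_mul].
  - rewrite <- !(comult_conv coalg_H), al, PiL_conv by ty; reflexivity.
  - rewrite <- !(comult_conv coalg_H), (wh_antipode wh) by ty; reflexivity.
  - rewrite p', !(conv_tens coalg_H Hcocomm), al, PiL_conv by ty; reflexivity.
  - rewrite p', !(conv_tens coalg_H Hcocomm), (wh_antipode wh) by ty; reflexivity.
  - rewrite <- !(comult_conv coalg_H), p', !(conv_tens coalg_H Hcocomm), al by ty.
    apply (base_like_commute coalg_H Hcocomm); ty.
  - rewrite <- !(comult_conv coalg_H), p', !(conv_tens coalg_H Hcocomm), ar by ty.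
    apply (base_like_commute coalg_H Hcocomm); ty.
Qed.

End CocommWeakHopf.

(** * Weak module algebras *)
Section Action.
Variable C : strictSymMonCat.
Variable H : weakHopf C.
Variables (B : algebra C) (phi : mor C).
Hypothesis HB : weak_module_algebra H B phi.
Let phi_H : phi ∈ H ⊗ B ⟶ B := wma_hom HB.
Let coalg_H : is_coalgebra H (counit H) (comult H) := wh_coalgebra (wh_axioms H).
Let delta_H : comult H ∈ H ⟶ H ⊗ H := delta_hom coalg_H.
Let eps_H : counit H ∈ H ⟶ unit_ob := eps_hom coalg_H.

Variables (D : ob C) (eps delta : mor C).
Hypothesis coalg_D : is_coalgebra D eps delta.
Hypothesis cocomm_D : sym D D ∘ delta = delta.
Let delta_D : delta ∈ D ⟶ D ⊗ D := delta_hom coalg_D.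
Let eps_D : eps ∈ D ⟶ unit_ob := eps_hom coalg_D.
Local Notation K := unit_ob.
Local Notation pair := (pairing D delta).
Local Notation pp := (pair K K).
Local Notation u1 := (phi ∘ (H ⊗ eta B)).

(** h⊗h'⊗a⊗b ↦ (h·a)(h'·b). *)
Definition diag_act : mor C := mu B ∘ ((phi ⊗ phi) ∘ (H ⊗ sym H B ⊗ B)).

Lemma act_mu Y x w : x ∈ D ⟶ H -> w ∈ D ⊗ Y ⟶ B ⊗ B ->
  phi ∘ pair K Y x (mu B ∘ w) = diag_act ∘ pair K Y (comult H ∘ x) w.
Proof.
  intros hx hw.
  transitivity (phi ∘ ((H ⊗ mu B) ∘ pair K Y x w)).
  { rewrite (tens_pair delta_D), id_l by ty; reflexivity. }
  rewrite comp_assoc, (wma_mult HB) by ty.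
  transitivity (diag_act ∘ ((comult H ⊗ (B ⊗ B)%ob) ∘ pair K Y x w)).
  - unfold diag_act; rewrite !comp_assoc by ty.
    do 2 f_equal; flat.
  - now rewrite (tens_pair delta_D), id_l by ty.
Qed.

Lemma diag_act_pair_l Y y z a f : y ∈ D ⟶ H -> z ∈ D ⟶ H -> a ∈ D ⟶ B -> f ∈ D ⊗ Y ⟶ B ->
  diag_act ∘ pair K Y (pp y z) (pair K Y a f)
  = mu B ∘ pair K Y (phi ∘ pp y a) (phi ∘ pair K Y z f).
Proof.
  intros hy hz ha hf; unfold diag_act.
  rewrite (pair_ppv coalg_D), <- (pair_ppp coalg_D) by ty.
  rewrite <- !comp_assoc by ty. f_equal.
  rewrite (tens_pair delta_D), (tens_pair delta_D (p := H)), !id_l by ty.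
  assert (ha' : a ∈ D ⊗ K ⟶ B) by (split; ty).
  rewrite (pair_swap coalg_D cocomm_D hz ha').
  rewrite (pair_ppp coalg_D), <- (pair_ppv coalg_D), (tens_pair delta_D) by ty.
  reflexivity.
Qed.

Lemma diag_act_pair_r Y y z a f : y ∈ D ⟶ H -> z ∈ D ⟶ H -> a ∈ D ⟶ B -> f ∈ D ⊗ Y ⟶ B ->
  diag_act ∘ pair K Y (pp y z) (pair Y K f a)
  = mu B ∘ pair Y K (phi ∘ pair K Y y f) (phi ∘ pp z a).
Proof.
  intros hy hz ha hf; unfold diag_act.
  rewrite (pair_pvp coalg_D), <- (pair_ppv coalg_D) by ty.
  rewrite <- !comp_assoc by ty. f_equal.
  rewrite (tens_pair delta_D), (tens_pair delta_D (p := H)), !id_l by ty.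
  rewrite (pair_swap coalg_D cocomm_D hz hf).
  rewrite (pair_pvp coalg_D), <- (pair_vpp coalg_D), (tens_pair delta_D) by ty.
  reflexivity.
Qed.

(** The case δ(x) = y⊗z of x·(ab) = Σ (x₁·a)(x₂·b), with the linear variable in
    the second factor here and in the first one in [act_mul_r]. *)
Lemma act_mul_l Y x y z a f : x ∈ D ⟶ H -> y ∈ D ⟶ H -> z ∈ D ⟶ H -> comult H ∘ x = pp y z ->
  a ∈ D ⟶ B -> f ∈ D ⊗ Y ⟶ B ->
  phi ∘ pair K Y x (mu B ∘ pair K Y a f)
  = mu B ∘ pair K Y (phi ∘ pp y a) (phi ∘ pair K Y z f).
Proof.
  intros hx hy hz e ha hf.
  rewrite act_mu, e by ty; now apply diag_act_pair_l.
Qed.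
Lemma act_mul_r Y x y z a f : x ∈ D ⟶ H -> y ∈ D ⟶ H -> z ∈ D ⟶ H -> comult H ∘ x = pp y z ->
  a ∈ D ⟶ B -> f ∈ D ⊗ Y ⟶ B ->
  phi ∘ pair K Y x (mu B ∘ pair Y K f a)
  = mu B ∘ pair Y K (phi ∘ pair K Y y f) (phi ∘ pp z a).
Proof.
  intros hx hy hz e ha hf.
  rewrite act_mu, e by ty; now apply diag_act_pair_r.
Qed.

Lemma pair_const_l' Y b v : b ∈ K ⟶ cod b -> dom v = (D ⊗ Y)%ob ->
  pair K Y (b ∘ eps) v = (b ⊗ cod v) ∘ v.
Proof.
  intros hb hv; rewrite (pair_point_l coalg_D) by ty.
  rewrite <- (@id_l _ (cod v) v) at 1 by ty.
  rewrite tensm_comp, <- (tens_merge' (f := eps) (g := v) (A := K) (B := (D ⊗ Y)%ob)) by ty.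
  rewrite <- tensm_id, tensm_assoc.
  rewrite <- !comp_assoc, <- tens_comp_r, (delta_epsl coalg_D), tensm_unitl, tensm_id by ty.
  f_equal; apply id_r; ty.
Qed.

Lemma mu_one_l Y f : f ∈ D ⊗ Y ⟶ B -> mu B ∘ pair K Y (eta B ∘ eps) f = f.
Proof.
  intros hf; rewrite pair_const_l', (hom_cod hf), comp_assoc, mu_etal by ty; apply id_l; ty.
Qed.
Lemma mu_one_r Y f : f ∈ D ⊗ Y ⟶ B -> mu B ∘ pair Y K f (eta B ∘ eps) = f.
Proof.
  intros hf. assert (ho : eta B ∘ eps ∈ D ⟶ B) by ty.
  rewrite <- (pair_swap coalg_D cocomm_D ho hf), pair_const_l', (hom_cod hf) by ty.
  rewrite (comp_assoc (h := sym B B)), (sym_natural_l B (eta_hom B)), sym_unit_l, id_r by ty.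
  rewrite comp_assoc, mu_etar by ty; apply id_l; ty.
Qed.

Lemma act_one a : a ∈ D ⟶ H -> phi ∘ pp a (eta B ∘ eps) = u1 ∘ a.
Proof.
  intros ha; rewrite (pair_const_r coalg_D), (hom_cod ha) by ty; now apply comp_assoc; ty.
Qed.

Lemma diag_act_unit_l : diag_act ∘ (H ⊗ H ⊗ eta B ⊗ B) = mu B ∘ (u1 ⊗ phi).
Proof.
  unfold diag_act.
  assert (e : (H ⊗ sym H B ⊗ B) ∘ (H ⊗ H ⊗ eta B ⊗ B) = H ⊗ eta B ⊗ (H ⊗ B)%ob).
  { rewrite <- (tensm_assoc H H), tens3_comp, (sym_natural_r H (eta_hom B)), sym_unit_r by ty.
    rewrite (id_r (f := eta B ⊗ H)), !id_l by ty; flat. }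
  rewrite <- !comp_assoc, e, <- tensm_comp, (id_r (f := phi)) by ty; reflexivity.
Qed.

Lemma diag_act_unit_r : diag_act ∘ (H ⊗ H ⊗ B ⊗ eta B) = mu B ∘ ((phi ⊗ u1) ∘ (H ⊗ sym H B)).
Proof.
  unfold diag_act.
  assert (e : (H ⊗ sym H B ⊗ B) ∘ (H ⊗ H ⊗ B ⊗ eta B) = ((H ⊗ B)%ob ⊗ (H ⊗ eta B)) ∘ (H ⊗ sym H B)).
  { transitivity ((H ⊗ sym H B ⊗ B) ∘ ((H ⊗ H ⊗ B)%ob ⊗ eta B)); [f_equal; flat|].
    transitivity (((H ⊗ B ⊗ H)%ob ⊗ eta B) ∘ ((H ⊗ sym H B) ⊗ K)); [|rewrite tensm_unitr; f_equal; flat].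
    now rewrite tens_merge, tens_merge' by ty. }
  rewrite <- !comp_assoc, e, (comp_assoc (h := phi ⊗ phi)), <- tensm_comp, (id_r (f := phi)) by ty; reflexivity.
Qed.

(** x·f = Σ u(x₁)(x₂·f), from f = 1f; the variant [act_unfold_r], from f = f1,
    reads x·f = Σ (x₁·f)u(x₂). *)
Lemma act_unfold_l Y x f : x ∈ D ⟶ H -> f ∈ D ⊗ Y ⟶ B ->
  phi ∘ pair K Y x f = mu B ∘ (u1 ⊗ phi) ∘ pair K Y (comult H ∘ x) f.
Proof.
  intros hx hf; rewrite <- (mu_one_l hf) at 1.
  rewrite act_mu, pair_const_l', (hom_cod hf) by ty.
  rewrite <- diag_act_unit_l.
  rewrite <- comp_assoc by (unfold diag_act; ty). f_equal.
  transitivity (((H ⊗ H)%ob ⊗ (eta B ⊗ B)) ∘ pair K Y (comult H ∘ x) f); [|f_equal; flat].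
  now rewrite (tens_pair delta_D), id_l by ty.
Qed.
Lemma act_unfold_r Y x f : x ∈ D ⟶ H -> f ∈ D ⊗ Y ⟶ B ->
  phi ∘ pair K Y x f
  = mu B ∘ ((phi ⊗ u1) ∘ (H ⊗ sym H B)) ∘ pair K Y (comult H ∘ x) f.
Proof.
  intros hx hf; rewrite <- (mu_one_r hf) at 1.
  assert (ho : eta B ∘ eps ∈ D ⟶ B) by ty.
  assert (e : pair Y K f (eta B ∘ eps) = (B ⊗ eta B) ∘ f).
  { rewrite <- (pair_swap coalg_D cocomm_D ho hf), pair_const_l', (hom_cod hf) by ty.
    rewrite (comp_assoc (h := sym B B)), (sym_natural_l B (eta_hom B)), sym_unit_l, id_r by ty; reflexivity. }
  rewrite act_mu, e by ty.
  rewrite <- diag_act_unit_r.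
  rewrite <- comp_assoc by (unfold diag_act; ty). f_equal.
  transitivity (((H ⊗ H)%ob ⊗ (B ⊗ eta B)) ∘ pair K Y (comult H ∘ x) f); [|f_equal; flat].
  now rewrite (tens_pair delta_D), id_l by ty.
Qed.

Lemma u1_mu : u1 ∘ mu H = phi ∘ (H ⊗ u1).
Proof. exact (wma_weak HB). Qed.

(** If δ(x) = δ(k)(e⊗1), then x·f = Σ u(k₁e)(k₂·f) = Σ (k₁·u(e))(k₂·f), which is
    k·(u(e)f).  In [act_mul_base_r] the factor e sits in the second leg and u(e)
    comes out on the right; together they make u(e) central. *)
Lemma act_mul_base_l Y x k e f :
  x ∈ D ⟶ H -> k ∈ D ⟶ H -> e ∈ D ⟶ H -> f ∈ D ⊗ Y ⟶ B ->
  comult H ∘ x = (mu H ⊗ H) ∘ ((H ⊗ sym H H) ∘ pp (comult H ∘ k) e) ->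
  phi ∘ pair K Y x f = phi ∘ pair K Y k (mu B ∘ pair K Y (u1 ∘ e) f).
Proof.
  intros hx hk he hf ex.
  rewrite act_unfold_l, ex, act_mu by ty.
  assert (e1 : pair K Y ((mu H ⊗ H) ∘ ((H ⊗ sym H H) ∘ pp (comult H ∘ k) e)) f
    = (mu H ⊗ H ⊗ B) ∘ ((H ⊗ sym H H ⊗ B) ∘ pair K Y (pp (comult H ∘ k) e) f))
    by now rewrite (tens_pair delta_D (p := H ⊗ sym H H) (q := B)),
      (tens_pair delta_D (p := mu H ⊗ H) (q := B)), !id_l by ty.
  assert (e2 : pair K Y (comult H ∘ k) (pair K Y (u1 ∘ e) f)
    = ((H ⊗ H)%ob ⊗ (u1 ⊗ B)) ∘ pair K Y (pp (comult H ∘ k) e) f).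
  { rewrite <- (pair_ppv coalg_D), !(tens_pair delta_D), !id_l by ty; reflexivity. }
  rewrite e1, e2.
  assert (hx2 : pair K Y (pp (comult H ∘ k) e) f ∈ D ⊗ Y ⟶ H ⊗ H ⊗ H ⊗ B) by ty.
  revert hx2; generalize (pair K Y (pp (comult H ∘ k) e) f); intros t ht.
  unfold diag_act; rewrite <- !comp_assoc by ty; f_equal.
  transitivity ((phi ⊗ phi) ∘ (((H ⊗ u1) ⊗ (H ⊗ B)%ob) ∘ ((H ⊗ sym H H ⊗ B) ∘ t))).
  - rewrite !comp_assoc by ty; do 2 f_equal.
    rewrite <- (tensm_assoc (mu H)), tensm_id, <- !tensm_comp, u1_mu, !id_r by ty; reflexivity.
  - f_equal. rewrite !comp_assoc by ty; f_equal.
    transitivity ((H ⊗ (u1 ⊗ H) ⊗ B) ∘ (H ⊗ sym H H ⊗ B)); [f_equal; flat|].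
    transitivity ((H ⊗ sym H B ⊗ B) ∘ (H ⊗ (H ⊗ u1) ⊗ B)); [|f_equal; flat].
    assert (hu : u1 ∈ H ⟶ B) by ty.
    rewrite !tens3_comp, (sym_natural_r H hu) by ty; reflexivity.
Qed.

Lemma act_mul_base_r Y x k e f :
  x ∈ D ⟶ H -> k ∈ D ⟶ H -> e ∈ D ⟶ H -> f ∈ D ⊗ Y ⟶ B ->
  comult H ∘ x = (H ⊗ mu H) ∘ pp (comult H ∘ k) e ->
  phi ∘ pair K Y x f = phi ∘ pair K Y k (mu B ∘ pair Y K f (u1 ∘ e)).
Proof.
  intros hx hk he hf ex.
  rewrite act_unfold_r, ex, act_mu by ty.
  assert (e1 : pair K Y ((H ⊗ mu H) ∘ pp (comult H ∘ k) e) f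
    = (H ⊗ mu H ⊗ B) ∘ pair K Y (pp (comult H ∘ k) e) f)
    by now rewrite (tens_pair delta_D (q := B)), id_l by ty.
  assert (e2 : pair K Y (comult H ∘ k) (pair Y K f (u1 ∘ e))
    = ((H ⊗ H)%ob ⊗ (B ⊗ u1)) ∘ (((H ⊗ H)%ob ⊗ sym H B) ∘ pair K Y (pp (comult H ∘ k) e) f)).
  { rewrite <- (pair_ppv coalg_D), (tens_pair delta_D (q := sym H B)), id_l by ty.
    rewrite (pair_swap coalg_D cocomm_D he hf), (tens_pair delta_D), id_l by ty.
    rewrite (tens_pair delta_D (p := B)), id_l by ty; reflexivity. }
  rewrite e1, e2.
  assert (hx2 : pair K Y (pp (comult H ∘ k) e) f ∈ D ⊗ Y ⟶ H ⊗ H ⊗ H ⊗ B) by ty.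
  revert hx2; generalize (pair K Y (pp (comult H ∘ k) e) f); intros t ht.
  unfold diag_act; rewrite <- !comp_assoc by ty; f_equal.
  assert (hu : u1 ∈ H ⟶ B) by ty.
  transitivity ((phi ⊗ phi) ∘ (((H ⊗ B)%ob ⊗ (H ⊗ u1)) ∘ ((H ⊗ sym (H ⊗ H) B) ∘ t))).
  - rewrite !comp_assoc by ty; f_equal.
    rewrite <- (tensm_comp (g := phi) (g' := phi)), <- u1_mu, (id_r (f := phi)) by ty.
    rewrite <- (comp_assoc (h := phi ⊗ u1)), <- (tensm_assoc H (mu H) B), <- tens_comp_l by ty.
    rewrite (sym_natural_l B (mu_hom H)), tens_comp_l, comp_assoc by ty.
    f_equal.
    transitivity ((phi ⊗ u1) ∘ ((H ⊗ B)%ob ⊗ mu H)); [f_equal; flat|].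
    rewrite <- tensm_comp, (id_r (f := phi)) by ty; reflexivity.
  - f_equal. rewrite !comp_assoc by ty; f_equal.
    clear e2; revert hu; generalize u1; intros u hu.
    rewrite sym_hexagon_l, tens_comp_l, comp_assoc by ty.
    transitivity (((H ⊗ sym H B ⊗ B) ∘ ((H ⊗ H ⊗ B)%ob ⊗ u)) ∘ (H ⊗ H ⊗ sym H B)); [|f_equal; [f_equal; flat|flat]].
    rewrite tens_merge by ty.
    f_equal; [|flat].
    transitivity (((H ⊗ B ⊗ H)%ob ⊗ u) ∘ ((H ⊗ sym H B) ⊗ H)); [f_equal; flat|].
    now rewrite tens_merge' by ty.
Qed.
End Action.

(** * Grouplike points *)
Section GenericElements.
Variable C : strictSymMonCat.
Variable H : weakHopf C.
Hypothesis Hcocomm : cocommutative H.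
Variables (B : algebra C) (phi : mor C).
Hypothesis HB : weak_module_algebra H B phi.
Let phi_H : phi ∈ H ⊗ B ⟶ B := wma_hom HB.
Let wh := wh_axioms H.
Let coalg_H : is_coalgebra H (counit H) (comult H) := wh_coalgebra wh.
Let delta_H : comult H ∈ H ⟶ H ⊗ H := delta_hom coalg_H.
Let eps_H : counit H ∈ H ⟶ unit_ob := eps_hom coalg_H.
Let lam_H : antipode H ∈ H ⟶ H := wh_antipode_hom wh.
Let PiL_H := PiL_hom H.

Variables (D : ob C) (eps delta : mor C).
Hypothesis coalg_D : is_coalgebra D eps delta.
Hypothesis cocomm_D : sym D D ∘ delta = delta.
Let delta_D : delta ∈ D ⟶ D ⊗ D := delta_hom coalg_D.
Let eps_D : eps ∈ D ⟶ unit_ob := eps_hom coalg_D.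
Local Notation K := unit_ob.
Local Notation pair := (pairing D delta).
Local Notation pp := (pair K K).
Local Notation u1 := (phi ∘ (H ⊗ eta B)).
Local Notation one := (eta H ∘ eps).
Local Notation HH := (tens_algebra H H).
Local Notation "h ★ k" := (conv H delta h k) (at level 45).
Implicit Types (h k j e a b : mor C).

(** Compatible with comultiplication only: the product of two such points need
    not be counital in a weak Hopf algebra. *)
Definition grouplike h := h ∈ D ⟶ H /\ comult H ∘ h = pp h h.

Lemma comult_pow h k : grouplike h -> grouplike k ->
  delta_tens H H (comult H) (comult H) ∘ pp h k = pp (pp h k) (pp h k).
Proof.
  intros [hh eh] [hk ek]; unfold delta_tens.
  rewrite <- comp_assoc, (tens_pair delta_D), eh, ek by ty.
  pose proof (@pair_interchange _ _ _ _ coalg_D cocomm_D h h k k H H (hom_dom hh) hh hk (hom_dom hk)) as e.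
  rewrite (hom_cod hh), (hom_cod hk) in e; exact e.
Qed.

(** A point of E that the coproduct copies preserves comultiplication, and
    convolution is natural for such morphisms. *)
Lemma conv_precomp (A : algebra C) (E : ob C) (dE p q x : mor C) :
  dE ∈ E ⟶ E ⊗ E -> p ∈ E ⟶ A -> q ∈ E ⟶ A -> x ∈ D ⟶ E ->
  dE ∘ x = pp x x -> conv A dE p q ∘ x = mu A ∘ pp (p ∘ x) (q ∘ x).
Proof.
  intros hd hp hq hx e; unfold conv.
  rewrite <- comp_assoc, e, <- comp_assoc, (tens_pair delta_D) by ty; reflexivity.
Qed.

Lemma grouplike_conv h k : grouplike h -> grouplike k -> grouplike (h ★ k).
Proof.
  intros [hh eh] [hk ek]; split; [ty|].
  rewrite (comult_conv coalg_D), eh, ek, (conv_tens coalg_D cocomm_D) by ty; reflexivity.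
Qed.

Lemma grouplike_antipode h : grouplike h -> grouplike (antipode H ∘ h).
Proof.
  intros [hh eh]; split; [ty|].
  rewrite comp_assoc, (comult_antipode Hcocomm), <- comp_assoc, eh, (tens_pair delta_D) by ty; reflexivity.
Qed.

Lemma conv_target h : grouplike h -> h ★ (antipode H ∘ h) = PiL H ∘ h.
Proof.
  intros [hh eh]. rewrite (conv_pair coalg_D) by ty.
  pose proof (wh_antipodel wh) as e; fold (PiL H) in e; rewrite <- e.
  rewrite (conv_precomp (x := h) delta_H), id_l by ty; reflexivity.
Qed.

Lemma conv_target_self h : grouplike h -> (h ★ (antipode H ∘ h)) ★ h = h.
Proof.
  intros gh; pose proof gh as [hh eh]. rewrite conv_target by auto.
  rewrite (conv_pair coalg_D) by ty.
  rewrite <- (id_l (f := h) (B := H)) at 2 by ty.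
  rewrite <- (conv_precomp (x := h) delta_H), (PiL_conv Hcocomm), id_l by ty; reflexivity.
Qed.

Lemma target_base_like a : a ∈ D ⟶ H -> base_like H D eps delta (PiL H ∘ a).
Proof.
  intros ha; apply (base_like_comp coalg_D); try ty; [apply comult_PiL_l|apply comult_PiL_r].
Qed.

Lemma comult_conv_one k : k ∈ D ⟶ H ->
  conv HH delta (comult H ∘ k) (comult H ∘ eta H ∘ eps) = comult H ∘ k.
Proof.
  intros hk; rewrite <- (comult_one H coalg_D), <- (comult_conv coalg_D), (conv_unitr coalg_D) by ty; reflexivity.
Qed.

(** For e = Π(l), δ(ke) = δ(k)δ(1)(e⊗1) = δ(k)(e⊗1) for every point k, whether
    grouplike or not.  Taking k = 1 shows that e acts as multiplication by u(e),
    on the left and on the right. *)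
Lemma act_target_l Y k l f : k ∈ D ⟶ H -> l ∈ D ⟶ H -> f ∈ D ⊗ Y ⟶ B ->
  phi ∘ pair K Y (k ★ (PiL H ∘ l)) f
  = phi ∘ pair K Y k (mu B ∘ pair K Y (u1 ∘ (PiL H ∘ l)) f).
Proof.
  intros hk hl hf; apply (act_mul_base_l HB coalg_D); try ty.
  destruct (target_base_like hl) as [_ e].
  rewrite (comult_conv coalg_D), e, (conv_assoc coalg_D), comult_conv_one by ty.
  now rewrite (conv_tens_actr coalg_D) by ty.
Qed.

Lemma act_target_r Y k l f : k ∈ D ⟶ H -> l ∈ D ⟶ H -> f ∈ D ⊗ Y ⟶ B ->
  phi ∘ pair K Y (k ★ (PiL H ∘ l)) f
  = phi ∘ pair K Y k (mu B ∘ pair Y K f (u1 ∘ (PiL H ∘ l))).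
Proof.
  intros hk hl hf; apply (act_mul_base_r HB coalg_D cocomm_D); try ty.
  assert (he : PiL H ∘ l ∈ D ⟶ H) by ty.
  destruct (base_like_sym Hcocomm coalg_D cocomm_D he (target_base_like hl)) as [_ e].
  rewrite (comult_conv coalg_D), e, (conv_assoc coalg_D), comult_conv_one by ty.
  now rewrite (conv_tens_actr' coalg_D) by ty.
Qed.

Lemma act_unit Y f : f ∈ D ⊗ Y ⟶ B -> phi ∘ pair K Y one f = f.
Proof.
  intros hf; rewrite (pair_const_l' coalg_D), (hom_cod hf), comp_assoc, (wma_unit HB) by ty.
  apply id_l; ty.
Qed.

Lemma act_target_unit_l Y l f : l ∈ D ⟶ H -> f ∈ D ⊗ Y ⟶ B ->
  phi ∘ pair K Y (PiL H ∘ l) f = mu B ∘ pair K Y (u1 ∘ (PiL H ∘ l)) f.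
Proof.
  intros hl hf.
  rewrite <- (conv_unitl coalg_D (A := H) (a := PiL H ∘ l)) at 1 by ty.
  rewrite act_target_l, act_unit by ty; reflexivity.
Qed.
Lemma act_target_unit_r Y l f : l ∈ D ⟶ H -> f ∈ D ⊗ Y ⟶ B ->
  phi ∘ pair K Y (PiL H ∘ l) f = mu B ∘ pair Y K f (u1 ∘ (PiL H ∘ l)).
Proof.
  intros hl hf.
  rewrite <- (conv_unitl coalg_D (A := H) (a := PiL H ∘ l)) at 1 by ty.
  rewrite act_target_r, act_unit by ty; reflexivity.
Qed.

Lemma u_conv h k : h ∈ D ⟶ H -> k ∈ D ⟶ H -> u1 ∘ (h ★ k) = phi ∘ pp h (u1 ∘ k).
Proof.
  intros hh hk; rewrite (conv_pair coalg_D), comp_assoc, (u1_mu HB), <- comp_assoc, (tens_pair delta_D), id_l by ty; reflexivity.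
Qed.

Lemma act_u_l Y h f : grouplike h -> f ∈ D ⊗ Y ⟶ B ->
  mu B ∘ pair K Y (u1 ∘ h) (phi ∘ pair K Y h f) = phi ∘ pair K Y h f.
Proof.
  intros [hh eh] hf.
  assert (ho : eta B ∘ eps ∈ D ⟶ B) by ty.
  rewrite <- (mu_one_l coalg_D hf) at 2.
  rewrite (act_mul_l HB coalg_D cocomm_D hh hh hh eh ho hf), (act_one HB coalg_D) by ty; reflexivity.
Qed.
Lemma act_u_r Y h f : grouplike h -> f ∈ D ⊗ Y ⟶ B ->
  mu B ∘ pair Y K (phi ∘ pair K Y h f) (u1 ∘ h) = phi ∘ pair K Y h f.
Proof.
  intros [hh eh] hf.
  assert (ho : eta B ∘ eps ∈ D ⟶ B) by ty.
  rewrite <- (mu_one_r coalg_D cocomm_D hf) at 2.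
  rewrite (act_mul_r HB coalg_D cocomm_D hh hh hh eh ho hf), (act_one HB coalg_D) by ty; reflexivity.
Qed.

Lemma mul_ppv Y a b v : a ∈ D ⟶ B -> b ∈ D ⟶ B -> v ∈ D ⊗ Y ⟶ B ->
  mu B ∘ pair K Y a (mu B ∘ pair K Y b v) = mu B ∘ pair K Y (mu B ∘ pp a b) v.
Proof.
  intros ha hb hv.
  rewrite <- (id_l (f := a) (B := B)) at 1 by ty. rewrite <- (id_l (f := v) (B := B)) at 2 by ty.
  rewrite <- !(tens_pair delta_D), !comp_assoc, (pair_ppv coalg_D), mu_assoc by ty; reflexivity.
Qed.
Lemma mul_pvp Y a b v : a ∈ D ⟶ B -> b ∈ D ⟶ B -> v ∈ D ⊗ Y ⟶ B ->
  mu B ∘ pair K Y a (mu B ∘ pair Y K v b) = mu B ∘ pair Y K (mu B ∘ pair K Y a v) b.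
Proof.
  intros ha hb hv.
  rewrite <- (id_l (f := a) (B := B)) at 1 by ty. rewrite <- (id_l (f := b) (B := B)) at 2 by ty.
  rewrite <- !(tens_pair delta_D), !comp_assoc, (pair_pvp coalg_D), mu_assoc by ty; reflexivity.
Qed.
Lemma mul_vpp Y a b v : a ∈ D ⟶ B -> b ∈ D ⟶ B -> v ∈ D ⊗ Y ⟶ B ->
  mu B ∘ pair Y K (mu B ∘ pair Y K v a) b = mu B ∘ pair Y K v (mu B ∘ pp a b).
Proof.
  intros ha hb hv.
  rewrite <- (id_l (f := b) (B := B)) at 1 by ty. rewrite <- (id_l (f := v) (B := B)) at 2 by ty.
  rewrite <- !(tens_pair delta_D), !comp_assoc, (pair_vpp coalg_D), mu_assoc by ty; reflexivity.
Qed.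

Section Sigma.
Variable s : mor C.
Hypothesis hs : s ∈ H ⊗ H ⟶ B.
Hypothesis s_twisted : twisted H B phi s.

(** One copy of k acts on v, and the other one passes v by [pair_swap]. *)
Lemma P_pair Y k v : grouplike k -> v ∈ D ⊗ Y ⟶ B ->
  P_ H B phi ∘ pair K Y k v = pair Y K (phi ∘ pair K Y k v) k.
Proof.
  intros [hk ek] hv; unfold P_.
  rewrite <- comp_assoc, (tens_pair delta_D), ek, id_l, <- (pair_ppv coalg_D) by ty.
  rewrite <- comp_assoc, (tens_pair delta_D), (pair_swap coalg_D cocomm_D hk hv), id_l by ty.
  rewrite (pair_pvp coalg_D), (tens_pair delta_D), id_l by ty; reflexivity.
Qed.

Lemma twisted_act Y h k v : grouplike h -> grouplike k -> v ∈ D ⊗ Y ⟶ B ->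
  mu B ∘ pair Y K (phi ∘ pair K Y h (phi ∘ pair K Y k v)) (s ∘ pp h k)
  = mu B ∘ pair K Y (s ∘ pp h k) (phi ∘ pair K Y (h ★ k) v).
Proof.
  intros gh gk hv; pose proof gh as [hh _]; pose proof gk as [hk _].
  assert (hP : P_ H B phi ∈ H ⊗ B ⟶ B ⊗ H) by (unfold P_; ty).
  assert (hF : F_ H s ∈ H ⊗ H ⟶ B ⊗ H) by (unfold F_, delta_tens; ty).
  pose proof (f_equal (fun x => x ∘ pair K Y h (pair K Y k v)) s_twisted) as e; cbv beta in e.
  rewrite <- !comp_assoc in e by ty.
  rewrite (tens_pair delta_D), id_l, P_pair in e by (auto; ty).
  rewrite (pair_pvp coalg_D), (tens_pair delta_D), id_l, P_pair in e by (auto; ty).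
  rewrite <- (pair_vpp coalg_D), (tens_pair delta_D), id_l in e by ty.
  rewrite e, (pair_ppv coalg_D), (tens_pair delta_D), id_l by ty.
  assert (eF : F_ H s ∘ pp h k = pp (s ∘ pp h k) (h ★ k)).
  { unfold F_; rewrite <- comp_assoc, comult_pow, (tens_pair delta_D) by (auto; unfold delta_tens; ty).
    rewrite (conv_pair coalg_D) by ty; reflexivity. }
  rewrite eF, <- (pair_ppv coalg_D), (tens_pair delta_D), id_l by ty; reflexivity.
Qed.
End Sigma.

Lemma convn2 p q h k : p ∈ H ⊗ H ⟶ B -> q ∈ H ⊗ H ⟶ B -> grouplike h -> grouplike k ->
  mu B ∘ pp (p ∘ pp h k) (q ∘ pp h k) = convn H B 2 p q ∘ pp h k.
Proof.
  intros hp hq gh gk; pose proof gh as [hh _]; pose proof gk as [hk _].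
  unfold convn; rewrite (conv_precomp (E := (H ⊗ H)%ob) (x := pp h k)); try ty; auto;
   simpl; [unfold delta_tens; ty|now apply comult_pow].
Qed.

Lemma u2_pair h k : h ∈ D ⟶ H -> k ∈ D ⟶ H -> u_ H B phi 2 ∘ pp h k = u1 ∘ (h ★ k).
Proof.
  intros hh hk; unfold u_; simpl.
  rewrite tensm_id, id_r, <- comp_assoc, (conv_pair coalg_D) by ty; reflexivity.
Qed.
End GenericElements.

(** * The obstruction argument for operators on a bimodule *)
(** M stands for the points of B, V for the D-parametrised endomorphisms of B, a
    bimodule over M, and G for the grouplike points of H, which act on both.
    [u h] is h·1, [gm h (inv h)] is Π(h), and [tu] is the inverse of [sg]. *)
Section ObstructionAlgebra.
Variables M V G : Type.
Variables (mm : M -> M -> M) (lm : M -> V -> V) (rm : V -> M -> V).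
Hypothesis mm_assoc : forall a b c, mm a (mm b c) = mm (mm a b) c.
Hypothesis lm_lm : forall a b v, lm a (lm b v) = lm (mm a b) v.
Hypothesis rm_rm : forall v a b, rm (rm v a) b = rm v (mm a b).
Hypothesis lm_rm : forall a v b, lm a (rm v b) = rm (lm a v) b.
Variables (gm : G -> G -> G) (inv : G -> G).
Hypothesis gm_assoc : forall h k j, gm h (gm k j) = gm (gm h k) j.
Hypothesis gm_inv : forall h, gm (gm h (inv h)) h = h.
Variables (am : G -> M -> M) (av : G -> V -> V) (u : G -> M).
Hypothesis av_lm : forall h a v, av h (lm a v) = lm (am h a) (av h v).
Hypothesis av_rm : forall h v a, av h (rm v a) = rm (av h v) (am h a).
Hypothesis u_gm : forall h k, u (gm h k) = am h (u k).
Hypothesis am_ul : forall h a, mm (u h) (am h a) = am h a.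
Hypothesis av_ul : forall h v, lm (u h) (av h v) = av h v.
Hypothesis av_ur : forall h v, rm (av h v) (u h) = av h v.
Hypothesis am_tl : forall h a, am (gm h (inv h)) a = mm (u (gm h (inv h))) a.
Hypothesis am_tr : forall h a, am (gm h (inv h)) a = mm a (u (gm h (inv h))).
Hypothesis av_tl : forall h v, av (gm h (inv h)) v = lm (u (gm h (inv h))) v.
Hypothesis av_tr : forall h v, av (gm h (inv h)) v = rm v (u (gm h (inv h))).
Hypothesis av_gm_t : forall k h v,
  av (gm k (gm h (inv h))) v = av k (lm (u (gm h (inv h))) v).
Variables sg tu : G -> G -> M.
Hypothesis sg_tu : forall h k, mm (sg h k) (tu h k) = u (gm h k).
Hypothesis sg_tu_sg : forall h k, mm (mm (sg h k) (tu h k)) (sg h k) = sg h k.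
Hypothesis twist : forall h k v,
  rm (av h (av k v)) (sg h k) = lm (sg h k) (av (gm h k) v).

(** u(h)u(Π(h)) is h·1 times h·u(λ(h)), which is u(Π(h)); it is also Π(h)·u(h),
    which is u(Π(h)h) = u(h). *)
Lemma u_target h : u (gm h (inv h)) = u h.
Proof.
  transitivity (mm (u h) (u (gm h (inv h)))).
  - now rewrite u_gm, am_ul.
  - now rewrite <- am_tr, <- u_gm, gm_inv.
Qed.

Lemma u_central h a : mm (u h) a = mm a (u h).
Proof. now rewrite <- u_target, <- am_tl, am_tr. Qed.

Lemma u_central_v h v : lm (u h) v = rm v (u h).
Proof. now rewrite <- u_target, <- av_tl, av_tr. Qed.

(** A product σσ⁻¹ is idempotent, and u(h) = u(hλ(h)) is one. *)
Lemma u_idem h : mm (u h) (u h) = u h.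
Proof.
  rewrite <- u_target, <- sg_tu, mm_assoc, sg_tu_sg; reflexivity.
Qed.

Lemma av_av_u h k v : rm (av h (av k v)) (u (gm h k)) = av h (av k v).
Proof. now rewrite u_gm, <- av_rm, av_ur. Qed.

(** h·(λ(h)·b) is the conjugate of b by s = σ(h,λ(h)), up to u(h).  So λ(h)
    applied to v conjugated by the inverse of s is a preimage of u(h)v. *)
Lemma act_surjective h v : exists w, av h w = lm (u h) v.
Proof.
  set (s := sg h (inv h)); set (t := tu h (inv h)).
  exists (av (inv h) (lm t (rm v s))).
  rewrite <- av_av_u, <- sg_tu, <- rm_rm, twist, av_tl, lm_lm, lm_lm; fold s t.
  rewrite <- u_central; fold s.
  assert (e : mm (u (gm h (inv h))) s = s)
    by (unfold s; rewrite <- sg_tu; apply sg_tu_sg).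
  rewrite e, <- lm_rm, rm_rm.
  assert (st : mm s t = u h) by (unfold s, t; rewrite sg_tu; apply u_target).
  now rewrite st, <- u_central_v, lm_lm, u_idem.
Qed.

(** Preimages are found from h inwards; the units that appear on the way combine
    as (k·u(j))u(k) = u(kj). *)
Lemma act3_surjective h k j v :
  exists w, av h (av k (av j w)) = lm (u (gm (gm h k) j)) v.
Proof.
  destruct (act_surjective h v) as [v1 e1].
  destruct (act_surjective k v1) as [v2 e2].
  destruct (act_surjective j v2) as [w e3].
  exists w; rewrite e3, av_lm, e2, <- u_gm, lm_lm.
  assert (e : mm (u (gm k j)) (u k) = u (gm k j))
    by now rewrite <- u_central, u_gm, am_ul.
  rewrite e, av_lm, e1, lm_lm, <- u_gm, gm_assoc.
  now rewrite <- u_central, <- gm_assoc, u_gm, am_ul.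
Qed.

(** p₁ and p₃ are the inverses of σ(hk,j) and σ(h,kΠ(j)).  Both x and
    y = σ(h,kΠ(j))σ(hk,j) intertwine F, the action of hkj, with T, the iterated
    action; so x times the inverse of y commutes with the values of T. *)
Theorem obstruction_central h k j p1 p3 v :
  let U := u (gm (gm h k) j) in
  let s1 := sg (gm h k) j in
  let s3 := sg h (gm k (gm j (inv j))) in
  mm s1 p1 = U -> mm p1 s1 = U -> mm (mm p1 s1) p1 = p1 ->
  mm s3 p3 = U -> mm p3 s3 = U -> mm (mm p3 s3) p3 = p3 ->
  let w := mm (mm (mm (am h (sg k j)) (sg h (gm k j))) p1) p3 in
  lm w v = rm v w.
Proof.
  intros U s1 s3 a1 b1 c1 a3 b3 c3.
  set (x := mm (am h (sg k j)) (sg h (gm k j))). intros w.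
  set (T v := av h (av k (av j v))); set (F v := av (gm (gm h k) j) v).
  assert (x_twist : forall v, rm (T v) x = lm x (F v)).
  { intros v0; unfold T, x, F.
    rewrite <- rm_rm, <- av_rm, twist, av_lm, <- lm_rm, twist, lm_lm, gm_assoc; reflexivity. }
  set (y := mm s3 s1); set (y' := mm p1 p3).
  assert (y_twist : forall v, rm (T v) y = lm y (F v)).
  { intros v0; unfold T, y, F.
    (* Π(j) is invisible in front of j·v, since u(j)(j·v) = j·v. *)
    assert (e : av k (av j v0) = av (gm k (gm j (inv j))) (av j v0))
      by now rewrite av_gm_t, u_target, av_ul.
    assert (e' : av (gm h (gm k (gm j (inv j)))) (av j v0) = av (gm h k) (av j v0))
      by now rewrite gm_assoc, av_gm_t, u_target, av_ul.
    rewrite <- rm_rm, e; unfold s3; rewrite twist, e', <- lm_rm; unfold s1; rewrite twist.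
    apply lm_lm. }
  assert (up3 : mm U p3 = p3) by now rewrite <- b3.
  assert (up1 : mm U p1 = p1) by now rewrite <- b1.
  assert (Uc : forall a, mm U a = mm a U) by (intros; apply u_central).
  assert (y'y : mm y' y = U).
  { unfold y, y'. rewrite <- mm_assoc, (mm_assoc p3), b3, mm_assoc, <- Uc, up1; exact b1. }
  assert (yy' : mm y y' = U).
  { unfold y, y'. rewrite <- mm_assoc, (mm_assoc s1), a1, up3; exact a3. }
  assert (fy : forall v, rm (F v) y' = lm y' (T v)).
  { intros v0.
    assert (e : F v0 = lm y' (lm y (F v0)))
      by (rewrite lm_lm, y'y; symmetry; apply av_ul).
    rewrite e, <- y_twist, <- lm_rm, rm_rm, yy'; f_equal.
    unfold T, U; rewrite <- gm_assoc, u_gm, <- av_rm, av_av_u; reflexivity. }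
  assert (ew : w = mm x y') by (unfold w, y'; symmetry; apply mm_assoc).
  assert (tw : forall v, rm (T v) w = lm w (T v)).
  { intros v0; rewrite ew, <- rm_rm, x_twist, <- lm_rm, fy; apply lm_lm. }
  destruct (act3_surjective h k j v) as [v0 e].
  specialize (tw v0); unfold T in tw; rewrite e in tw; fold U in tw.
  assert (Uw : mm U w = w).
  { rewrite Uc; unfold w; rewrite <- mm_assoc, <- Uc, up3; reflexivity. }
  rewrite lm_lm, <- Uc, Uw in tw; rewrite <- tw.
  unfold U; rewrite u_central_v, rm_rm; fold U; now rewrite Uw.
Qed.
End ObstructionAlgebra.

(** * Points of the algebra as such a bimodule *)
Section Instance.
Variable C : strictSymMonCat.
Variable H : weakHopf C.
Hypothesis Hcocomm : cocommutative H.
Variables (B : algebra C) (phi : mor C).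
Hypothesis HB : weak_module_algebra H B phi.
Let phi_H : phi ∈ H ⊗ B ⟶ B := wma_hom HB.
Variables (D : ob C) (eps delta : mor C).
Hypothesis coalg_D : is_coalgebra D eps delta.
Hypothesis cocomm_D : sym D D ∘ delta = delta.
Let delta_D : delta ∈ D ⟶ D ⊗ D := delta_hom coalg_D.
Local Notation K := unit_ob.
Local Notation pair := (pairing D delta).
Local Notation pp := (pair K K).
Local Notation u1 := (phi ∘ (H ⊗ eta B)).
Local Notation "h ★ k" := (conv H delta h k) (at level 45).
Local Notation "a ⋆ b" := (mu B ∘ pp a b) (at level 45).
Local Notation gl := (grouplike H D delta).
Variables s t : mor C.
Hypothesis hs : s ∈ H ⊗ H ⟶ B.
Hypothesis s_twisted : twisted H B phi s.
Hypothesis ht : is_reg_inv H B phi 2 s t.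

(** Subtypes carrying the typing, so that the operators become total. *)
Definition glpoint := {h : mor C | gl h}.
Definition scalar := point D B.
Definition vec := {v : mor C | v ∈ D ⊗ B ⟶ B}.

Lemma scalar_mul_hom (a b : scalar) : proj1_sig a ⋆ proj1_sig b ∈ D ⟶ B.
Proof. destruct a, b; simpl; ty. Qed.
Lemma vec_lmul_hom (a : scalar) (v : vec) : mu B ∘ pair K B (proj1_sig a) (proj1_sig v) ∈ D ⊗ B ⟶ B.
Proof. destruct a, v; simpl; ty. Qed.
Lemma vec_rmul_hom (v : vec) (a : scalar) : mu B ∘ pair B K (proj1_sig v) (proj1_sig a) ∈ D ⊗ B ⟶ B.
Proof. destruct a, v; simpl; ty. Qed.
Lemma scalar_act_hom (h : glpoint) (a : scalar) : phi ∘ pp (proj1_sig h) (proj1_sig a) ∈ D ⟶ B.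
Proof. destruct a, h as [h [hh e]]; simpl; ty. Qed.
Lemma vec_act_hom (h : glpoint) (v : vec) : phi ∘ pair K B (proj1_sig h) (proj1_sig v) ∈ D ⊗ B ⟶ B.
Proof. destruct v, h as [h [hh e]]; simpl; ty. Qed.
Lemma glpoint_unit_hom (h : glpoint) : u1 ∘ proj1_sig h ∈ D ⟶ B.
Proof. destruct h as [h [hh e]]; simpl; ty. Qed.
Lemma scalar_pair_hom p (h k : glpoint) : p ∈ H ⊗ H ⟶ B -> p ∘ pp (proj1_sig h) (proj1_sig k) ∈ D ⟶ B.
Proof. destruct h as [h [hh e]], k as [k [hk e']]; simpl; intros; ty. Qed.

Definition scalar_mul (a b : scalar) : scalar := exist _ _ (scalar_mul_hom a b).
Definition vec_lmul a v : vec := exist _ _ (vec_lmul_hom a v).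
Definition vec_rmul v a : vec := exist _ _ (vec_rmul_hom v a).
Definition glpoint_mul (h k : glpoint) : glpoint :=
  exist _ _ (grouplike_conv coalg_D cocomm_D (proj2_sig h) (proj2_sig k)).
Definition glpoint_antipode (h : glpoint) : glpoint :=
  exist _ _ (grouplike_antipode Hcocomm coalg_D (proj2_sig h)).
Definition scalar_act h a : scalar := exist _ _ (scalar_act_hom h a).
Definition vec_act h v : vec := exist _ _ (vec_act_hom h v).
Definition glpoint_unit h : scalar := exist _ _ (glpoint_unit_hom h).
Definition scalar_pair p (hp : p ∈ H ⊗ H ⟶ B) h k : scalar := exist _ _ (scalar_pair_hom h k hp).

Let t_hom : t ∈ H ⊗ H ⟶ B := proj1 ht.

Lemma conv_sigma_inv h k : gl h -> gl k -> (s ∘ pp h k) ⋆ (t ∘ pp h k) = u1 ∘ (h ★ k).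
Proof.
  intros gh gk; rewrite (convn2 coalg_D cocomm_D hs t_hom gh gk).
  pose proof ht as ht'; destruct ht' as [_ [-> _]]; apply (u2_pair HB coalg_D (proj1 gh) (proj1 gk)).
Qed.
Lemma conv_inv_sigma h k : gl h -> gl k -> (t ∘ pp h k) ⋆ (s ∘ pp h k) = u1 ∘ (h ★ k).
Proof.
  intros gh gk; rewrite (convn2 coalg_D cocomm_D t_hom hs gh gk).
  pose proof ht as ht'; destruct ht' as [_ [_ [-> _]]]; apply (u2_pair HB coalg_D (proj1 gh) (proj1 gk)).
Qed.
Let st_hom : convn H B 2 s t ∈ H ⊗ H ⟶ B.
Proof. pose proof (delta_hom (wh_coalgebra (wh_axioms H))). unfold convn, conv; simpl; unfold delta_tens; ty. Qed.
Let ts_hom : convn H B 2 t s ∈ H ⊗ H ⟶ B.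
Proof. pose proof (delta_hom (wh_coalgebra (wh_axioms H))). unfold convn, conv; simpl; unfold delta_tens; ty. Qed.
Lemma conv_sigma_inv_sigma h k : gl h -> gl k ->
  ((s ∘ pp h k) ⋆ (t ∘ pp h k)) ⋆ (s ∘ pp h k) = s ∘ pp h k.
Proof.
  intros gh gk; rewrite (convn2 coalg_D cocomm_D hs t_hom gh gk).
  rewrite (convn2 coalg_D cocomm_D st_hom hs gh gk).
  pose proof ht as ht'; destruct ht' as [_ [_ [_ [-> _]]]]; reflexivity.
Qed.
Lemma conv_inv_sigma_inv h k : gl h -> gl k ->
  ((t ∘ pp h k) ⋆ (s ∘ pp h k)) ⋆ (t ∘ pp h k) = t ∘ pp h k.
Proof.
  intros gh gk; rewrite (convn2 coalg_D cocomm_D t_hom hs gh gk).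
  rewrite (convn2 coalg_D cocomm_D ts_hom t_hom gh gk).
  pose proof ht as ht'; destruct ht' as [_ [_ [_ [_ ->]]]]; reflexivity.
Qed.

Lemma obstruction_commutes h k j p1 p3 v :
  gl h -> gl k -> gl j -> p1 ∈ D ⟶ B -> p3 ∈ D ⟶ B -> v ∈ D ⊗ B ⟶ B ->
  let U := u1 ∘ ((h ★ k) ★ j) in
  let s1 := s ∘ pp (h ★ k) j in
  let s3 := s ∘ pp h (k ★ (PiL H ∘ j)) in
  s1 ⋆ p1 = U -> p1 ⋆ s1 = U -> (p1 ⋆ s1) ⋆ p1 = p1 ->
  s3 ⋆ p3 = U -> p3 ⋆ s3 = U -> (p3 ⋆ s3) ⋆ p3 = p3 ->
  let w := (((phi ∘ pp h (s ∘ pp k j)) ⋆ (s ∘ pp h (k ★ j))) ⋆ p1) ⋆ p3 in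
  mu B ∘ pair K B w v = mu B ∘ pair B K v w.
Proof.
  intros gh gk gj hp1 hp3 hv U s1 s3 a1 b1 c1 a3 b3 c3 w.
  assert (hv' : v ∈ D ⊗ B ⟶ B) by exact hv.
  pose (x1 := exist _ p1 hp1 : scalar). pose (x3 := exist _ p3 hp3 : scalar).
  pose (h' := exist _ h gh : glpoint). pose (k' := exist _ k gk : glpoint).
  pose (j' := exist _ j gj : glpoint). pose (v' := exist _ v hv' : vec).
  (* The goals below are the axioms of the abstract setting, in its order,
     followed by the relations satisfied by p₁ and p₃. *)
  refine (f_equal (@proj1_sig _ _)
    (@obstruction_central scalar vec glpoint scalar_mul vec_lmul vec_rmul _ _ _ _
      glpoint_mul glpoint_antipode _ _ scalar_act vec_act glpoint_unit _ _ _ _ _ _ _ _ _ _ _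
      (scalar_pair hs) (scalar_pair t_hom) _ _ _ h' k' j' x1 x3 v' _ _ _ _ _ _)).
  all: match goal with |- @eq (sig _) _ _ => apply sig_eq | |- _ => idtac end.
  all: try (intros [x hx] [y hy] [z hz]; apply sig_eq).
  all: try (intros [x hx] [y hy]; apply sig_eq).
  all: try (intros [x hx]; apply sig_eq).
  all: cbn [proj1_sig scalar_mul vec_lmul vec_rmul glpoint_mul glpoint_antipode
     scalar_act vec_act glpoint_unit scalar_pair h' k' j' v' x1 x3].
  - rewrite (mul_ppv coalg_D (Y := K)) by ty; reflexivity.
  - rewrite (mul_ppv coalg_D) by ty; reflexivity.
  - rewrite (mul_vpp coalg_D) by ty; reflexivity.
  - rewrite (mul_pvp coalg_D) by ty; reflexivity.
  - destruct hx, hy, hz; apply (conv_assoc coalg_D); ty.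
  - apply (conv_target_self Hcocomm coalg_D hx).
  - destruct hx; apply (act_mul_l HB coalg_D cocomm_D); ty.
  - destruct hx; apply (act_mul_r HB coalg_D cocomm_D); ty.
  - destruct hx, hy; apply (u_conv HB coalg_D); ty.
  - apply (act_u_l HB coalg_D cocomm_D (Y := K)); auto; ty.
  - apply (act_u_l HB coalg_D cocomm_D); auto; ty.
  - apply (act_u_r HB coalg_D cocomm_D); auto; ty.
  - rewrite (conv_target coalg_D hx); destruct hx; apply (act_target_unit_l HB coalg_D (Y := K)); ty.
  - rewrite (conv_target coalg_D hx); destruct hx; apply (act_target_unit_r Hcocomm HB coalg_D cocomm_D (Y := K)); ty.
  - rewrite (conv_target coalg_D hx); destruct hx; apply (act_target_unit_l HB coalg_D); ty.
  - rewrite (conv_target coalg_D hx); destruct hx; apply (act_target_unit_r Hcocomm HB coalg_D cocomm_D); ty.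
  - rewrite (conv_target coalg_D hy); destruct hx, hy; apply (act_target_l HB coalg_D); ty.
  - apply conv_sigma_inv; auto.
  - apply conv_sigma_inv_sigma; auto.
  - apply (twisted_act HB coalg_D cocomm_D hs s_twisted); auto.
  - apply sig_eq; exact a1.
  - apply sig_eq; exact b1.
  - apply sig_eq; exact c1.
  - apply sig_eq; cbn; rewrite (conv_target coalg_D gj); exact a3.
  - apply sig_eq; cbn; rewrite (conv_target coalg_D gj); exact b3.
  - apply sig_eq; cbn; rewrite (conv_target coalg_D gj); exact c3.
Qed.
End Instance.

(** * The generic point of the third tensor power *)
Section Centralizing.
Variable C : strictSymMonCat.
Variable B : algebra C.
Variables (D : ob C) (eps delta : mor C).
Hypothesis coalg_D : is_coalgebra D eps delta.
Hypothesis cocomm_D : sym D D ∘ delta = delta.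
Let delta_D : delta ∈ D ⟶ D ⊗ D := delta_hom coalg_D.
Let eps_D : eps ∈ D ⟶ unit_ob := eps_hom coalg_D.
Local Notation K := unit_ob.
Local Notation pair := (pairing D delta).

(** It suffices to commute with the generic element of B, which is the identity
    of B, constant in the parameter. *)
Lemma centralizes_of_commutes w : w ∈ D ⟶ B ->
  mu B ∘ pair K B w (eps ⊗ B) = mu B ∘ pair B K (eps ⊗ B) w ->
  centralizes B w.
Proof.
  intros hw e; unfold centralizes.
  assert (hv : eps ⊗ B ∈ D ⊗ B ⟶ B) by ty.
  rewrite <- (pair_swap coalg_D cocomm_D hw hv) in e.
  assert (p : pair K B w (eps ⊗ B) = w ⊗ B).
  { rewrite (pair_point_l coalg_D) by ty.
    rewrite tensm_assoc, <- tens_comp_r by ty.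
    rewrite <- (tens_merge (f := w) (g := eps) (A := D) (B := K)), <- comp_assoc by ty.
    now rewrite (delta_epsr coalg_D), tensm_unitr, id_r by ty. }
  rewrite p in e.
  assert (b : B ⊗ w = sym B B ∘ (w ⊗ B) ∘ sym B D).
  { rewrite (sym_natural_l B hw), <- comp_assoc, sym_inv, id_r by ty; reflexivity. }
  assert (e' : mu B ∘ (sym B B ∘ (w ⊗ B)) = mu B ∘ (w ⊗ B)) by (symmetry; exact e).
  rewrite b, <- (comp_assoc (h := mu B) (g := sym B B)) by ty.
  rewrite (comp_assoc (h := mu B) (f := sym B D)), e' by ty.
  rewrite <- (comp_assoc (h := sym B B) (f := sym B D)), (comp_assoc (h := sym B B) (g := sym B B)) by ty.
  rewrite sym_inv, id_l, <- comp_assoc by ty; reflexivity.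
Qed.
End Centralizing.

Section TriplePower.
Variable C : strictSymMonCat.
Variable H : weakHopf C.
Hypothesis Hcocomm : cocommutative H.
Variables (B : algebra C) (phi : mor C).
Hypothesis HB : weak_module_algebra H B phi.
Let phi_H : phi ∈ H ⊗ B ⟶ B := wma_hom HB.
Let coalg_H : is_coalgebra H (counit H) (comult H) := wh_coalgebra (wh_axioms H).
Let delta_H : comult H ∈ H ⟶ H ⊗ H := delta_hom coalg_H.
Let eps_H : counit H ∈ H ⟶ unit_ob := eps_hom coalg_H.
Let lam_H : antipode H ∈ H ⟶ H := wh_antipode_hom (wh_axioms H).
Let PiL_H := PiL_hom H.
Local Notation u1 := (phi ∘ (H ⊗ eta B)).
Local Notation K := unit_ob.

Section UnitTarget.
Variables (D : ob C) (eps delta : mor C).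
Hypothesis coalg_D : is_coalgebra D eps delta.
Hypothesis cocomm_D : sym D D ∘ delta = delta.
Let delta_D : delta ∈ D ⟶ D ⊗ D := delta_hom coalg_D.
(** The argument of [u_target], at any coalgebra D of parameters. *)
Lemma unit_target h : grouplike H D delta h -> u1 ∘ (PiL H ∘ h) = u1 ∘ h.
Proof.
  intros gh; pose proof gh as [hh _].
  transitivity (mu B ∘ pairing D delta K K (u1 ∘ h) (u1 ∘ (PiL H ∘ h))).
  - rewrite <- (conv_target coalg_D gh), (u_conv HB coalg_D) by ty.
    symmetry; apply (act_u_l HB coalg_D cocomm_D (Y := K)); auto; ty.
  - rewrite <- (act_target_unit_r Hcocomm HB coalg_D cocomm_D (Y := K)) by ty.
    rewrite <- (u_conv HB coalg_D), <- (conv_target coalg_D gh) by ty.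
    now rewrite (conv_target_self Hcocomm coalg_D gh).
Qed.

End UnitTarget.

Local Notation HH := (H ⊗ H)%ob.
Local Notation D := (pow_ob H 3).
Local Notation delta2 := (pow_delta H 2).
Local Notation delta := (pow_delta H 3).
Local Notation eps2 := (counit H ⊗ counit H).
Local Notation eps := (eps2 ⊗ counit H).
Local Notation pair := (pairing D delta).
Local Notation pp := (pair K K).

Let coalg_2 : is_coalgebra HH eps2 delta2 := tens_is_coalgebra coalg_H coalg_H.
Let coalg_3 : is_coalgebra D eps delta := tens_is_coalgebra coalg_2 coalg_H.
Let cocomm_2 : sym HH HH ∘ delta2 = delta2 := tens_cocommutative coalg_H coalg_H Hcocomm Hcocomm.
Let cocomm_3 : sym D D ∘ delta = delta := tens_cocommutative coalg_2 coalg_H cocomm_2 Hcocomm.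
Let delta_2 : delta2 ∈ HH ⟶ HH ⊗ HH := delta_hom coalg_2.
Let delta_3 : delta ∈ D ⟶ D ⊗ D := delta_hom coalg_3.

(** The three projections of D onto H.  They are the coordinates of the generic
    point: pairing them gives the identity of D, so a morphism on D is determined
    by its value at (x1, x2, x3). *)
Let fst12 : mor C := proj_l HH (counit H).
Let x1 : mor C := proj_l H (counit H) ∘ fst12.
Let x2 : mor C := proj_r H (counit H) ∘ fst12.
Let x3 : mor C := proj_r H eps2.

Let fst12_hom : fst12 ∈ D ⟶ HH. Proof. unfold fst12, proj_l; ty. Qed.
Let x1_hom : x1 ∈ D ⟶ H. Proof. unfold x1, fst12, proj_l; ty. Qed.
Let x2_hom : x2 ∈ D ⟶ H. Proof. unfold x2, fst12, proj_l, proj_r; ty. Qed.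
Let x3_hom : x3 ∈ D ⟶ H. Proof. unfold x3, proj_r; ty. Qed.

Lemma comult_comp (X Y Z : ob C) dX dY dZ p q :
  dX ∈ X ⟶ X ⊗ X -> dY ∈ Y ⟶ Y ⊗ Y -> dZ ∈ Z ⟶ Z ⊗ Z -> q ∈ X ⟶ Y -> p ∈ Y ⟶ Z ->
  (q ⊗ q) ∘ dX = dY ∘ q -> (p ⊗ p) ∘ dY = dZ ∘ p ->
  dZ ∘ (p ∘ q) = ((p ∘ q) ⊗ (p ∘ q)) ∘ dX.
Proof.
  intros hX hY hZ hq hp eq ep.
  rewrite comp_assoc, <- ep, <- comp_assoc, <- eq, comp_assoc, tensm_comp by ty; reflexivity.
Qed.

Let gl1 : grouplike H D delta x1.
Proof.
  split; [exact x1_hom|]. rewrite (pair_points coalg_3) by ty.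
  apply (@comult_comp D HH H delta delta2); auto; try apply fst12_hom.
  - apply (proj_l_hom H coalg_H).
  - apply (proj_l_comult coalg_2 coalg_H).
  - apply (proj_l_comult coalg_H coalg_H).
Qed.
Let gl2 : grouplike H D delta x2.
Proof.
  split; [exact x2_hom|]. rewrite (pair_points coalg_3) by ty.
  apply (@comult_comp D HH H delta delta2); auto; try apply fst12_hom.
  - apply (proj_r_hom H coalg_H).
  - apply (proj_l_comult coalg_2 coalg_H).
  - apply (proj_r_comult coalg_H coalg_H).
Qed.
Let gl3 : grouplike H D delta x3.
Proof.
  split; [exact x3_hom|]. rewrite (pair_points coalg_3) by ty.
  symmetry; apply (proj_r_comult coalg_2 coalg_H).
Qed.

Let pair_12 : pp x1 x2 = fst12.
Proof.
  pose proof (proj_l_hom H coalg_H). pose proof (proj_r_hom H coalg_H).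
  pose proof fst12_hom.
  rewrite (pair_points coalg_3) by ty; unfold x1, x2.
  rewrite tensm_comp, <- comp_assoc by ty.
  pose proof (proj_l_comult coalg_2 coalg_H) as e; fold fst12 in e.
  transitivity ((proj_l H (counit H) ⊗ proj_r H (counit H)) ∘ (delta2 ∘ fst12)); [f_equal; exact e|].
  rewrite comp_assoc by ty.
  pose proof (proj_pair coalg_H coalg_H) as e2.
  transitivity (idm HH ∘ fst12); [f_equal; exact e2|]. apply id_l; ty.
Qed.

Let pair_12_3 : pp (pp x1 x2) x3 = idm D.
Proof.
  pose proof fst12_hom; pose proof x3_hom.
  rewrite pair_12, (pair_points coalg_3) by ty.
  exact (proj_pair coalg_2 coalg_H).
Qed.
Let pair_1_23 : pp x1 (pp x2 x3) = idm D.
Proof.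
  pose proof x1_hom; pose proof x2_hom; pose proof x3_hom.
  rewrite (pair_ppp coalg_3) by ty; exact pair_12_3.
Qed.

Local Notation "h ★ k" := (conv H delta h k) (at level 45).

(** The coboundary operators take their values at the generic point: x1, x2, x3
    paired with either bracketing give the identity of D. *)
Lemma d20_at s : s ∈ HH ⟶ B -> d20 H phi s = phi ∘ pp x1 (s ∘ pp x2 x3).
Proof.
  intros hs; pose proof x1_hom; pose proof x2_hom; pose proof x3_hom.
  unfold d20; rewrite <- (id_r (f := phi ∘ (H ⊗ s)) (A := D)), <- pair_1_23 by ty.
  rewrite <- comp_assoc, (tens_pair delta_3), id_l by ty; reflexivity.
Qed.
Lemma d22_at s : s ∈ HH ⟶ B -> d22 H s = s ∘ pp x1 (x2 ★ x3).
Proof.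
  intros hs; pose proof x1_hom; pose proof x2_hom; pose proof x3_hom.
  unfold d22; rewrite <- (id_r (f := s ∘ (H ⊗ mu H)) (A := D)), <- pair_1_23 by ty.
  rewrite <- comp_assoc, (tens_pair delta_3), id_l, (conv_pair coalg_3) by ty; reflexivity.
Qed.
Lemma d21_at s : s ∈ HH ⟶ B -> d21 H s = s ∘ pp (x1 ★ x2) x3.
Proof.
  intros hs; pose proof x1_hom; pose proof x2_hom; pose proof x3_hom.
  unfold d21; rewrite <- (id_r (f := s ∘ (mu H ⊗ H)) (A := D)), <- pair_12_3 by ty.
  rewrite <- comp_assoc, (tens_pair delta_3), id_l, (conv_pair coalg_3) by ty; reflexivity.
Qed.
Lemma d23_at s : s ∈ HH ⟶ B -> d23 H s = s ∘ pp x1 (x2 ★ (PiL H ∘ x3)).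
Proof.
  intros hs; pose proof x1_hom; pose proof x2_hom; pose proof x3_hom.
  unfold d23; rewrite <- (id_r (f := s ∘ _) (A := D)), <- pair_1_23 by ty.
  rewrite <- comp_assoc, (tens_pair delta_3), id_l, (conv_pair coalg_3) by ty.
  rewrite <- comp_assoc, (tens_pair delta_3), id_l by ty; reflexivity.
Qed.
Lemma u3_at : u_ H B phi 3 = u1 ∘ ((x1 ★ x2) ★ x3).
Proof.
  pose proof x1_hom; pose proof x2_hom; pose proof x3_hom.
  unfold u_; simpl pow_mu; rewrite tensm_id, id_r by ty.
  f_equal. rewrite <- (id_r (f := mu H ∘ (mu H ⊗ H)) (A := D)), <- pair_12_3 by ty.
  rewrite <- comp_assoc, (tens_pair delta_3), id_l, !(conv_pair coalg_3) by ty; reflexivity.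
Qed.

Section Sigma.
Variables s t : mor C.
Hypothesis hs : s ∈ HH ⟶ B.
Hypothesis ht : is_reg_inv H B phi 2 s t.

(** σ⁻¹(h,k) is inverse to σ(h,k) in Reg(H⊗H⊗H, B) whenever u(hk) is the unit of
    that group.  This provides inverses for the images of σ under the second and
    the last coboundary operator. *)
Lemma is_reg_inv_pair h k : grouplike H D delta h -> grouplike H D delta k ->
  u1 ∘ (h ★ k) = u_ H B phi 3 -> is_reg_inv H B phi 3 (s ∘ pp h k) (t ∘ pp h k).
Proof.
  intros gh gk e; pose proof gh as [hh _]; pose proof gk as [hk _].
  pose proof (proj1 ht : t ∈ HH ⟶ B) as t_hom.
  unfold is_reg_inv, convn; rewrite !(conv_pair coalg_3) by ty. rewrite <- e.
  split; [ty|]. repeat split.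
  - apply (conv_sigma_inv HB coalg_3 cocomm_3 hs ht gh gk).
  - apply (conv_inv_sigma HB coalg_3 cocomm_3 hs ht gh gk).
  - apply (conv_sigma_inv_sigma coalg_3 cocomm_3 hs ht gh gk).
  - apply (conv_inv_sigma_inv coalg_3 cocomm_3 hs ht gh gk).
Qed.

Lemma reg_inv_spec n f g : is_reg_inv H B phi n f g -> is_reg_inv H B phi n f (reg_inv H B phi n f).
Proof. intros hg; unfold reg_inv; apply epsilon_spec; now exists g. Qed.

Lemma preobstruction_centralizes :
  twisted H B phi s ->
  preobstruction H B phi s ∈ D ⟶ B /\ centralizes B (preobstruction H B phi s).
Proof.
  intros tw.
  pose proof x1_hom; pose proof x2_hom; pose proof x3_hom.
  pose proof (grouplike_conv coalg_3 cocomm_3 gl1 gl2) as g12.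
  pose proof (conv_target coalg_3 gl3) as e3.
  pose proof (grouplike_conv coalg_3 cocomm_3 gl3 (grouplike_antipode Hcocomm coalg_3 gl3)) as ge.
  rewrite e3 in ge.
  pose proof (grouplike_conv coalg_3 cocomm_3 gl2 ge) as g23.
  pose proof (reg_inv_spec (is_reg_inv_pair g12 gl3 (eq_sym u3_at))) as r1.
  (* u(kΠ(l)) = k·u(Π(l)) = k·u(l) = u(kl). *)
  assert (u3' : u1 ∘ (x1 ★ (x2 ★ (PiL H ∘ x3))) = u_ H B phi 3).
  { rewrite (u_conv HB coalg_3), (u_conv HB coalg_3), (unit_target coalg_3 cocomm_3 gl3) by ty.
    rewrite <- !(u_conv HB coalg_3), (conv_assoc coalg_3), u3_at by ty; reflexivity. }
  pose proof (reg_inv_spec (is_reg_inv_pair gl1 g23 u3')) as r3.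
  unfold preobstruction; rewrite d20_at, d21_at, d22_at, d23_at by exact hs.
  revert r1 r3.
  generalize (reg_inv H B phi 3 (s ∘ pp (x1 ★ x2) x3)).
  generalize (reg_inv H B phi 3 (s ∘ pp x1 (x2 ★ (PiL H ∘ x3)))).
  intros p3 p1 r1 r3.
  unfold is_reg_inv in r1, r3; destruct r1 as [hp1 r1]; destruct r3 as [hp3 r3].
  change (p1 ∈ D ⟶ B) in hp1; change (p3 ∈ D ⟶ B) in hp3.
  unfold convn in *; rewrite !(conv_pair coalg_3 (A := B)) in r1, r3 by ty.
  rewrite !(conv_pair coalg_3 (A := B)) by ty.
  rewrite u3_at in r1, r3.
  destruct r1 as [a1 [b1 [_ c1]]], r3 as [a3 [b3 [_ c3]]].
  split; [ty|].
  apply (centralizes_of_commutes coalg_3 cocomm_3); [ty|].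
  apply (obstruction_commutes Hcocomm HB coalg_3 cocomm_3 hs tw ht gl1 gl2 gl3 hp1 hp3); auto; ty.
Qed.
End Sigma.
End TriplePower.

Theorem proposition5p9 (C : strictSymMonCat) (Csplit : idempotents_split C)
    (H : weakHopf C) (Hcocomm : cocommutative H)
    (B : algebra C) (phi : mor C) (HB : weak_module_algebra H B phi)
    (Z : center B)
    (sigma : mor C) (sigma_reg : reg H B phi 2 sigma)
    (sigma_twisted : twisted H B phi sigma) :
  factors_through_center Z (pow_ob H 3) (preobstruction H B phi sigma).
Proof.
  destruct sigma_reg as [hs [t ht]].
  destruct (preobstruction_centralizes Hcocomm HB hs ht sigma_twisted) as [hw cw].
  destruct (center_universal Z hw cw) as [f' [hf' _]].
  exists f'; exact hf'.
Qed.
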